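(* Let $0<t<\pi/2$, let $\tau/i>0$, let $\lambda,\mu\in\mathbb{R}$, and let $f\colon\mathbb{D}\to\mathbb{C}$ and $g\colon R_0\to\mathbb{C}$ be conformal mappings with Schwarzian derivatives $$\mathcal{S}_f(z)=R_{t,\lambda}(z),\qquad \mathcal{S}_g(\zeta)=\varphi_{\tau,\mu}(\zeta)$$ respectively, where $R_0$ is the rectangle associated with $\tau$. Suppose that $g(\zeta)=f(z)$ under the change of variable $\zeta=E(z)/2$ carrying $\mathbb{D}$ onto $R_0$. Then $\tau/i=M(t)$ and $$\mu=16\lambda\cos t+\frac{3+\cos 2t}{6}.$$
   Context: $\mathbb{D}$ is the open unit disk, and the Schwarzian derivative is $\mathcal{S}_f=(f''/f')'-\frac12(f''/f')^2$. For $0<t<\pi/2$ and $\lambda\in\mathbb{R}$, $R_{t,\lambda}$ is the rational function with $$\tfrac12R_{t,\lambda}(z)=\psi_{0,t}(z)-\lambda\psi_{1,t}(z),$$ $$\psi_{0,t}(z)=\frac{(\sin^2t)\left(z^4-(16\cos t)z^3+(4+2\cos 2t)z^2-(16\cos t)z+1\right)}{2\left(z^4-(2\cos 2t)z^2+1\right)^2},\qquad \psi_{1,t}(z)=\frac{-8\cos t}{z^4-(2\cos 2t)z^2+1}.$$ The elliptic integral $E$ (depending on $t$) is $$E(z)=\int_0^z\frac{dw}{\sqrt{(w-e^{it})(w+e^{-it})(w+e^{it})(w-e^{-it})}},\qquad |z|<1,$$ with the branch of the square root equal to $1$ at $w=0$ (extended continuously to $|z|=1$); it maps $\mathbb{D}$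 conformally onto a rectangle centered at the origin with sides parallel to the axes, the vertices corresponding to $\pm e^{\pm it}$. The conformal module is $M(t)=\mathrm{Im}\,E(i)/E(1)$. Given $\tau$ with $\tau/i>0$, let $\omega_1>0$ and $\omega_2=\tau\omega_1$ be the half-periods of a Weierstrass function $\wp$ with periods $2\omega_1,2\omega_2$; put $e_i=\wp(\omega_i)$ for $i=1,2,3$ with $\omega_3=\omega_1+\omega_2$, and let the periods be normalized by $e_1-e_2=4$, so they are uniquely determined by $\tau$. Then $$R_0=\{\zeta\colon -\tfrac{\omega_1}{2}<\mathrm{Re}\,\zeta<\tfrac{\omega_1}{2},\ -\tfrac{\mathrm{Im}\,\omega_2}{2}<\mathrm{Im}\,\zeta<\tfrac{\mathrm{Im}\,\omega_2}{2}\}$$ and, for real $\mu$, $$\varphi_{\tau,\mu}(\zeta)=-4\left(\wp\Big(\zeta+\frac{\omega_1+\omega_2}{2}\Big)+\wp\Big(\zeta+\frac{\omega_1-\omega_2}{2}\Big)\right)+4\mu .$$ *)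

(* Defs.v *)
From Stdlib Require Import Reals ZArith.
From Coquelicot Require Import Coquelicot.
Open Scope R_scope.
Open Scope C_scope.

Definition Cpos (z : C) : Prop := Im z = 0 /\ 0 < Re z.

Definition unit_disk (z : C) : Prop := Cmod z < 1.

(* Maps on an open set U are total functions C -> C of which only the values
   on U matter. *)
Definition conformal_on (U : C -> Prop) (f : C -> C) : Prop :=
  (forall z w : C, U z -> U w -> f z = f w -> z = w) /\
  (forall z : C, U z -> exists l : C, is_derive f z l /\ l <> 0).

(* f1 = f' and f2 = f'' on U, and S = (f''/f')' - (f''/f')^2 / 2 on U. *)
Definition is_schwarzian_on (U : C -> Prop) (f S : C -> C) : Prop :=
  exists f1 f2 : C -> C,
    (forall z : C, U z -> is_derive f z (f1 z) /\ f1 z <> 0) /\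
    (forall z : C, U z -> is_derive f1 z (f2 z)) /\
    (forall z : C, U z -> exists l : C,
       is_derive (fun w : C => f2 w / f1 w) z l /\
       S z = l - / 2 * (f2 z / f1 z) ^ 2).

Definition psi0 (t : R) (z : C) : C :=
  RtoC (sin t ^ 2) *
    (z ^ 4 - RtoC (16 * cos t) * z ^ 3 + RtoC (4 + 2 * cos (2 * t)) * z ^ 2
     - RtoC (16 * cos t) * z + 1)
  / (2 * (z ^ 4 - RtoC (2 * cos (2 * t)) * z ^ 2 + 1) ^ 2).

Definition psi1 (t : R) (z : C) : C :=
  RtoC (- 8 * cos t) / (z ^ 4 - RtoC (2 * cos (2 * t)) * z ^ 2 + 1).

Definition Rtl (t lambda : R) (z : C) : C :=
  2 * (psi0 t z - RtoC lambda * psi1 t z).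

Definition expi (t : R) : C := (cos t, sin t).

(* s is the branch on the disk of the square root of
   (w - e^{it})(w + e^{-it})(w + e^{it})(w - e^{-it}) with s(0) = 1. *)
Definition is_sqrt_branch (t : R) (s : C -> C) : Prop :=
  (forall w : C, unit_disk w ->
     s w ^ 2 = (w - expi t) * (w + expi (- t)) * (w + expi t) * (w - expi (- t))) /\
  (forall w : C, unit_disk w -> continuous s w) /\
  s 0 = 1.

(* The integral of h along the segment from 0 to z. *)
Definition segment_integral (h : C -> C) (z : C) : C :=
  RInt (V := C_R_CompleteNormedModule)
    (fun x : R => z * h (RtoC x * z)) 0%R 1%R.

(* E is determined on the disk by the integral, and on the unit circle (hence
   at 1 and i) by continuous extension; other values are irrelevant. *)
Definition is_elliptic_integral (t : R) (E : C -> C) : Prop :=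
  exists s : C -> C,
    is_sqrt_branch t s /\
    (forall z : C, unit_disk z -> E z = segment_integral (fun w : C => / s w) z) /\
    (forall z : C, Cmod z = 1 ->
       filterlim E (within unit_disk (locally z)) (locally (E z))).

Definition conformal_module (E : C -> C) : C := RtoC (Im (E Ci)) / E 1.

Definition lattice_term (w1 w2 z : C) (m n : Z) : C :=
  let w := RtoC (2 * IZR m) * w1 + RtoC (2 * IZR n) * w2 in
  if andb (m =? 0)%Z (n =? 0)%Z then 0 else / (z - w) ^ 2 - / w ^ 2.

(* The sum of the lattice terms over -N <= m, n <= N. *)
Definition lattice_sum (w1 w2 z : C) (N : nat) : C :=
  sum_n (G := C_AbelianMonoid) (fun j =>
    sum_n (G := C_AbelianMonoid) (fun k =>
      lattice_term w1 w2 z (Z.of_nat j - Z.of_nat N) (Z.of_nat k - Z.of_nat N))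
    (2 * N)) (2 * N).

(* Weierstrass function with half-periods w1, w2. The series converges
   absolutely off the lattice, so the square partial sums give its value; on
   the lattice the value is meaningless. *)
Definition wp (w1 w2 z : C) : C :=
  / z ^ 2 + ((real (Lim_seq (fun N => Re (lattice_sum w1 w2 z N))),
              real (Lim_seq (fun N => Im (lattice_sum w1 w2 z N)))) : C).

Definition rectangle (w1 : R) (w2 zeta : C) : Prop :=
  (- (w1 / 2) < Re zeta < w1 / 2 /\ - (Im w2 / 2) < Im zeta < Im w2 / 2)%R.

Definition phi (w1 : R) (w2 : C) (mu : R) (zeta : C) : C :=
  - 4 * (wp w1 w2 (zeta + (w1 + w2) / 2) + wp w1 w2 (zeta + (w1 - w2) / 2))
  + 4 * RtoC mu.

(* Main.v *)
Require Import Defs.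
From Stdlib Require Import Reals ZArith Lra Lia Psatz.
From Coquelicot Require Import Coquelicot.
Open Scope R_scope.
Open Scope C_scope.

(** The hypothesis [g (E z / 2) = f z] and the chain rule for the Schwarzian derivative
    give, with [P z = z^4 - 2 (cos 2t) z^2 + 1] and [E' = P^(-1/2)],
    [[ phi (E z / 2) = 4 P (Rtl - S_E) (z) = 64 lambda cos t + q (z), ]]
    where [q] is an explicit rational function that depends on [t] only. Since
    [phi = 4 mu - 4 U] with [U zeta = wp (zeta + (w1 + w2)/2) + wp (zeta + (w1 - w2)/2)],
    only the constant [4 mu - 64 lambda cos t] has to be identified, and for that finitely
    many values suffice: [z = 0] and the limits [z -> 1, -1, i, -i] along the diameters,
    which correspond to the centre of the rectangle and to the midpoints of its sides.

    The chain rule is needed on the two diameters only ([schwarzian_along_segment]). There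
    [E] is a real elliptic integral times a unit vector ([elliptic_on_direction]), and all
    derivatives are taken with respect to a real parameter. By the reflection principle and
    the injectivity of [E], inherited from [f], each diameter is mapped onto a full axis of
    the rectangle ([ray_integral_limit]). With [w1 = omega1], [w2 = tau omega1] this yields [E 1 = w1] and [E i = w2], hence
    the formula for the conformal module, and identifies the limits above.

    At these points [2 U (0) + U (w1/2) + U (-w1/2) + U (w2/2) + U (-w2/2)] is the sum of
    [wp] over the twelve points of exact order 4 modulo the period lattice, and this sum is
    0 ([wp_four_torsion_sum]). Indeed, grouping the partial sums by cosets expresses it
    through the Eisenstein series of weight 2 of the lattice of quarter periods, summed over
    squares, with the total coefficient [1 - 1/4 - 12/16 = 0]. All that has to be known is
    that this series converges in the sense of squares ([invsq_box_cv]): along each side of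
    a square the sum of [1 / h^2] is close to a telescoping sum, and the contributions of
    the horizontal and of the vertical sides cancel to leading order. The vanishing of the
    sum turns the five values of [q] into [mu]. *)

(** * Sums over squares of lattice points *)

(** Sum of [F m] over the integers [-N <= m <= N]. *)
Definition zsum (N : nat) (F : Z -> C) : C :=
  sum_n (G := C_AbelianMonoid) (fun j => F (Z.of_nat j - Z.of_nat N)%Z) (2 * N).

(** Sum of [F m n] over the square [-N <= m, n <= N]; the square partial sums that
    define [wp] are [box_sum]s by conversion. *)
Definition box_sum (N : nat) (F : Z -> Z -> C) : C :=
  zsum N (fun m => zsum N (F m)).

Lemma zsum_0 (F : Z -> C) : zsum 0 F = F 0%Z.
Proof. unfold zsum. apply sum_O. Qed.

Lemma zsum_S (N : nat) (F : Z -> C) :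
  zsum (S N) F = F (- Z.of_nat (S N))%Z + zsum N F + F (Z.of_nat (S N)).
Proof.
  unfold zsum.
  replace (2 * S N)%nat with (S (S (2 * N))) by lia.
  rewrite sum_Sn. unfold sum_n at 1.
  rewrite (sum_Sn_m _ 0 (S (2 * N))) by lia. rewrite <- sum_n_m_S.
  change (@plus C_AbelianMonoid) with Cplus.
  assert (E1 : (Z.of_nat 0 - Z.of_nat (S N) = - Z.of_nat (S N))%Z) by lia.
  assert (E2 : (Z.of_nat (S (S (2 * N))) - Z.of_nat (S N) = Z.of_nat (S N))%Z) by lia.
  rewrite E1, E2. do 2 f_equal.
  apply sum_n_ext. intro j. f_equal. lia.
Qed.

Lemma zsum_ext (N : nat) (F G : Z -> C) :
  (forall m, (- Z.of_nat N <= m <= Z.of_nat N)%Z -> F m = G m) -> zsum N F = zsum N G.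
Proof.
  induction N as [|N IH]; intros H.
  - rewrite !zsum_0. apply H. lia.
  - rewrite !zsum_S. rewrite IH by (intros; apply H; lia).
    rewrite !H by lia. reflexivity.
Qed.

Lemma zsum_plus (N : nat) (F G : Z -> C) :
  zsum N (fun m => F m + G m) = zsum N F + zsum N G.
Proof.
  induction N as [|N IH]; [rewrite !zsum_0 | rewrite !zsum_S, IH]; ring.
Qed.

Lemma zsum_scal (N : nat) (c : C) (F : Z -> C) :
  zsum N (fun m => c * F m) = c * zsum N F.
Proof.
  induction N as [|N IH]; [rewrite !zsum_0 | rewrite !zsum_S, IH]; ring.
Qed.

Lemma zsum_minus (N : nat) (F G : Z -> C) :
  zsum N (fun m => F m - G m) = zsum N F - zsum N G.
Proof.
  induction N as [|N IH]; [rewrite !zsum_0 | rewrite !zsum_S, IH]; ring.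
Qed.

Lemma zsum_opp_index (N : nat) (F : Z -> C) : zsum N (fun m => F (- m)%Z) = zsum N F.
Proof.
  induction N as [|N IH]; [rewrite !zsum_0; reflexivity|].
  rewrite !zsum_S, IH, Z.opp_involutive. ring.
Qed.

Lemma zsum_bound (N : nat) (F : Z -> C) (B : R) :
  (forall m, (- Z.of_nat N <= m <= Z.of_nat N)%Z -> (Cmod (F m) <= B)%R) ->
  (Cmod (zsum N F) <= (2 * INR N + 1) * B)%R.
Proof.
  induction N as [|N IH]; intros H.
  - rewrite zsum_0. simpl. specialize (H 0%Z ltac:(lia)). lra.
  - rewrite zsum_S.
    pose proof (H (- Z.of_nat (S N))%Z ltac:(lia)).
    pose proof (H (Z.of_nat (S N)) ltac:(lia)).
    specialize (IH ltac:(intros; apply H; lia)).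
    pose proof (Cmod_triangle (F (- Z.of_nat (S N))%Z + zsum N F) (F (Z.of_nat (S N)))).
    pose proof (Cmod_triangle (F (- Z.of_nat (S N))%Z) (zsum N F)).
    rewrite S_INR. lra.
Qed.

Lemma box_sum_ext (N : nat) (F G : Z -> Z -> C) :
  (forall m n, F m n = G m n) -> box_sum N F = box_sum N G.
Proof. intros H. apply zsum_ext. intros. apply zsum_ext. intros. apply H. Qed.

Lemma box_sum_minus (N : nat) (F G : Z -> Z -> C) :
  box_sum N (fun m n => F m n - G m n) = box_sum N F - box_sum N G.
Proof.
  unfold box_sum. rewrite <- zsum_minus. apply zsum_ext. intros. apply zsum_minus.
Qed.

Lemma box_sum_plus (N : nat) (F G : Z -> Z -> C) :
  box_sum N (fun m n => F m n + G m n) = box_sum N F + box_sum N G.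
Proof.
  unfold box_sum. rewrite <- zsum_plus. apply zsum_ext. intros. apply zsum_plus.
Qed.

Lemma box_sum_scal (N : nat) (c : C) (F : Z -> Z -> C) :
  box_sum N (fun m n => c * F m n) = c * box_sum N F.
Proof.
  unfold box_sum. rewrite <- zsum_scal. apply zsum_ext. intros. apply zsum_scal.
Qed.

Lemma box_sum_opp_index (N : nat) (F : Z -> Z -> C) :
  box_sum N (fun m n => F (- m)%Z (- n)%Z) = box_sum N F.
Proof.
  unfold box_sum. rewrite <- (zsum_opp_index N (fun m => zsum N (F m))).
  apply zsum_ext. intros. apply zsum_opp_index.
Qed.

(** Two consecutive squares differ by a ring: two full sides and two sides without
    their corners. *)
Lemma box_sum_S (N : nat) (F : Z -> Z -> C) :
  box_sum (S N) F = box_sum N F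
    + (zsum (S N) (F (- Z.of_nat (S N))%Z) + zsum (S N) (F (Z.of_nat (S N))))
    + (zsum N (fun m => F m (- Z.of_nat (S N))%Z) + zsum N (fun m => F m (Z.of_nat (S N)))).
Proof.
  unfold box_sum at 1. rewrite zsum_S.
  rewrite (zsum_ext N _ (fun m => F m (- Z.of_nat (S N))%Z + zsum N (F m) + F m (Z.of_nat (S N))))
    by (intros; apply zsum_S).
  rewrite !zsum_plus. fold (box_sum N F). ring.
Qed.

Lemma INR_S_pos (N : nat) : (0 < INR (S N))%R.
Proof. apply lt_0_INR. lia. Qed.

Lemma box_sum_S_bound (N : nat) (F : Z -> Z -> C) (B : R) :
  (forall m n, Z.max (Z.abs m) (Z.abs n) = Z.of_nat (S N) -> (Cmod (F m n) <= B)%R) ->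
  (Cmod (box_sum (S N) F - box_sum N F) <= 8 * INR (S N) * B)%R.
Proof.
  intros H. rewrite box_sum_S.
  set (a := zsum (S N) (F (- Z.of_nat (S N))%Z)). set (b := zsum (S N) (F (Z.of_nat (S N)))).
  set (c := zsum N (fun m => F m (- Z.of_nat (S N))%Z)).
  set (d := zsum N (fun m => F m (Z.of_nat (S N)))).
  replace (_ - _) with ((a + b) + (c + d)) by ring.
  pose proof (Cmod_triangle (a + b) (c + d)).
  pose proof (Cmod_triangle a b). pose proof (Cmod_triangle c d).
  assert (Cmod a <= (2 * INR (S N) + 1) * B)%R by (apply zsum_bound; intros; apply H; lia).
  assert (Cmod b <= (2 * INR (S N) + 1) * B)%R by (apply zsum_bound; intros; apply H; lia).
  assert (Cmod c <= (2 * INR N + 1) * B)%R by (apply zsum_bound; intros; apply H; lia).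
  assert (Cmod d <= (2 * INR N + 1) * B)%R by (apply zsum_bound; intros; apply H; lia).
  rewrite S_INR in *. lra.
Qed.

(** * Convergence of complex sequences *)

(** Convergence of a complex sequence, real and imaginary parts separately, which is
    how [wp] is defined. *)
Definition Clim_seq (u : nat -> C) (l : C) : Prop :=
  is_lim_seq (fun n => Re (u n)) (Re l) /\ is_lim_seq (fun n => Im (u n)) (Im l).

Lemma Im_le_Cmod (z : C) : (Rabs (Im z) <= Cmod z)%R.
Proof. eapply Rle_trans; [apply Rmax_r | apply Rmax_Cmod]. Qed.

Lemma Clim_seq_bound (u : nat -> C) (l : C) (b : nat -> R) (N0 : nat) :
  (forall n, (N0 <= n)%nat -> (Cmod (u n - l) <= b n)%R) -> is_lim_seq b 0 -> Clim_seq u l.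
Proof.
  intros Hb Hlim.
  assert (aux : forall v : nat -> R, forall x : R,
            (forall n, (N0 <= n)%nat -> (Rabs (v n - x) <= b n)%R) -> is_lim_seq v x).
  { intros v x Hv.
    apply is_lim_seq_ext with (fun n => ((v n - x) + x)%R); [intro; ring|].
    replace (Finite x) with (Finite (0 + x)) by (f_equal; ring).
    apply is_lim_seq_plus'; [| apply is_lim_seq_const].
    apply is_lim_seq_abs_0.
    apply is_lim_seq_le_le_loc with (fun _ => 0%R) b; [| apply is_lim_seq_const | exact Hlim].
    exists N0. intros n Hn. split; [apply Rabs_pos | apply Hv, Hn]. }
  split; apply aux; intros n Hn; eapply Rle_trans; [|exact (Hb n Hn)| |exact (Hb n Hn)].
  - apply (re_le_Cmod (u n - l)).
  - apply (Im_le_Cmod (u n - l)).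
Qed.

Lemma Clim_seq_ext (u v : nat -> C) (l : C) :
  (forall n, u n = v n) -> Clim_seq u l -> Clim_seq v l.
Proof.
  intros H [H1 H2]. split; (eapply is_lim_seq_ext; [|eassumption]);
    intro n; simpl; rewrite H; reflexivity.
Qed.

Lemma Clim_seq_const (c : C) : Clim_seq (fun _ => c) c.
Proof. split; apply is_lim_seq_const. Qed.

Lemma Clim_seq_plus (u v : nat -> C) (l k : C) :
  Clim_seq u l -> Clim_seq v k -> Clim_seq (fun n => u n + v n) (l + k).
Proof. intros [H1 H2] [H3 H4]. split; simpl; apply is_lim_seq_plus'; assumption. Qed.

Lemma Clim_seq_scal (c : C) (u : nat -> C) (l : C) :
  Clim_seq u l -> Clim_seq (fun n => c * u n) (c * l).
Proof.
  intros [H1 H2]. split; simpl.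
  - apply (is_lim_seq_minus' _ _ (Re c * Re l)%R (Im c * Im l)%R);
      apply (is_lim_seq_scal_l _ _ (Finite _)); assumption.
  - apply (is_lim_seq_plus' _ _ (Re c * Im l)%R (Im c * Re l)%R);
      apply (is_lim_seq_scal_l _ _ (Finite _)); assumption.
Qed.

Lemma Clim_seq_subseq (u : nat -> C) (l : C) (k : nat -> nat) :
  (forall n, (n <= k n)%nat) -> Clim_seq u l -> Clim_seq (fun n => u (k n)) l.
Proof.
  intros Hk [H1 H2].
  assert (F : filterlim k eventually eventually).
  { intros P [N HN]. exists N. intros n Hn. apply HN. specialize (Hk n). lia. }
  split.
  - apply (is_lim_seq_subseq (fun n => Re (u n)) _ k F H1).
  - apply (is_lim_seq_subseq (fun n => Im (u n)) _ k F H2).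
Qed.

Lemma Clim_seq_unique (u : nat -> C) (l k : C) :
  Clim_seq u l -> Clim_seq u k -> l = k.
Proof.
  intros [H1 H2] [H3 H4].
  apply is_lim_seq_unique in H1, H2, H3, H4.
  rewrite H1 in H3. rewrite H2 in H4.
  destruct l, k. simpl in *. f_equal; congruence.
Qed.

Lemma Clim_seq_Lim (u : nat -> C) (l : C) :
  Clim_seq u l ->
  ((real (Lim_seq (fun n => Re (u n))), real (Lim_seq (fun n => Im (u n)))) : C) = l.
Proof.
  intros [H1 H2]. rewrite (is_lim_seq_unique _ _ H1), (is_lim_seq_unique _ _ H2).
  destruct l. reflexivity.
Qed.

Lemma is_lim_seq_inv_S (K : R) : is_lim_seq (fun n => (K * / INR (S n))%R) 0.
Proof.
  replace (Finite 0) with (Rbar_mult K 0) by (simpl; f_equal; ring).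
  apply is_lim_seq_scal_l.
  replace (Finite 0) with (Rbar_inv p_infty) by reflexivity.
  apply is_lim_seq_inv; [| discriminate].
  apply (is_lim_seq_incr_1 INR). apply is_lim_seq_INR.
Qed.

Lemma inv_INR_S_telescope (n : nat) :
  (/ INR (S n) - / INR (S (S n)) = / (INR (S n) * INR (S (S n))))%R.
Proof.
  pose proof (INR_S_pos n). rewrite (S_INR (S n)). field. lra.
Qed.

(** Steps bounded by [K / ((n + 1) (n + 2))] sum to at most [K / (n + 1)]; this gives
    convergence with an explicit rate. The factor 2 bounds the passage from the real and
    imaginary parts to the modulus. *)
Lemma telescoping_cv (u : nat -> C) (K : R) (N0 : nat) :
  (forall n, (N0 <= n)%nat ->
     (Cmod (u (S n) - u n) <= K * / (INR (S n) * INR (S (S n))))%R) ->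
  exists l, Clim_seq u l /\
    forall n, (N0 <= n)%nat -> (Cmod (u n - l) <= 2 * (K * / INR (S n)))%R.
Proof.
  intros H.
  assert (HK : (0 <= K)%R).
  { specialize (H N0 (Nat.le_refl _)).
    pose proof (Cmod_ge_0 (u (S N0) - u N0)).
    pose proof (INR_S_pos N0). pose proof (INR_S_pos (S N0)).
    assert (0 < / (INR (S N0) * INR (S (S N0))))%R
      by (apply Rinv_0_lt_compat, Rmult_lt_0_compat; assumption).
    nra. }
  assert (step : forall n k, (N0 <= n)%nat ->
    (Cmod (u (n + k)%nat - u n) <= K * (/ INR (S n) - / INR (S (n + k))))%R).
  { intros n k Hn. induction k as [|k IH].
    - rewrite Nat.add_0_r. replace (u n - u n) with (RtoC 0) by ring.
      rewrite Cmod_0. lra.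
    - rewrite Nat.add_succ_r.
      replace (u (S (n + k)) - u n) with ((u (S (n + k)) - u (n + k)%nat) + (u (n + k)%nat - u n)) by ring.
      eapply Rle_trans; [apply Cmod_triangle|].
      specialize (H (n + k)%nat ltac:(lia)). rewrite <- inv_INR_S_telescope in H. lra. }
  assert (bd : forall n m, (N0 <= n)%nat -> (n <= m)%nat ->
    (Cmod (u m - u n) <= K * / INR (S n))%R).
  { intros n m Hn Hm. replace m with (n + (m - n))%nat by lia.
    eapply Rle_trans; [apply step; assumption|].
    apply Rmult_le_compat_l; [exact HK|].
    pose proof (INR_S_pos (n + (m - n))).
    assert (0 < / INR (S (n + (m - n))))%R by (apply Rinv_0_lt_compat; assumption). lra. }
  assert (cau : forall v : nat -> R,
    (forall n m, (Rabs (v m - v n) <= Cmod (u m - u n))%R) ->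
    exists x : R, is_lim_seq v x /\
      forall n, (N0 <= n)%nat -> (Rabs (v n - x) <= K * / INR (S n))%R).
  { intros v Hv.
    assert (E : ex_finite_lim_seq v).
    { apply ex_lim_seq_cauchy_corr. intros eps.
      pose proof (is_lim_seq_inv_S K) as L. apply is_lim_seq_spec in L.
      destruct (L (mkposreal (eps / 2) ltac:(destruct eps; simpl; lra))) as [N1 HN1].
      simpl in HN1.
      set (M := Nat.max N0 N1). exists M. intros n m Hn Hm.
      assert (B : forall p, (M <= p)%nat -> (Rabs (v p - v M) < eps / 2)%R).
      { intros p Hp. eapply Rle_lt_trans; [apply Hv|].
        eapply Rle_lt_trans; [apply bd; unfold M; lia|].
        specialize (HN1 M ltac:(unfold M; lia)).
        rewrite Rminus_0_r in HN1. eapply Rle_lt_trans; [apply Rle_abs|]. exact HN1. }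
      pose proof (B n Hn). pose proof (B m Hm).
      replace (v n - v m)%R with ((v n - v M) - (v m - v M))%R by ring.
      eapply Rle_lt_trans; [apply Rabs_triang|]. rewrite Rabs_Ropp. lra. }
    destruct E as [x Hx]. exists x. split; [exact Hx|].
    intros n Hn.
    assert (L : is_lim_seq (fun m => Rabs (v n - v m)) (Rabs (v n - x))).
    { apply (is_lim_seq_abs _ (Finite _)).
      apply (is_lim_seq_minus' _ _ (v n) x); [apply is_lim_seq_const | exact Hx]. }
    apply (is_lim_seq_le_loc _ _ (Rabs (v n - x)) (K * / INR (S n))%R) with (2 := L)
      (3 := is_lim_seq_const _).
    exists n. intros m Hm. rewrite Rabs_minus_sym.
    eapply Rle_trans; [apply Hv|]. apply bd; assumption. }
  destruct (cau (fun n => Re (u n))) as [x [Hx Bx]].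
  { intros n m. apply (re_le_Cmod (u m - u n)). }
  destruct (cau (fun n => Im (u n))) as [y [Hy By]].
  { intros n m. apply (Im_le_Cmod (u m - u n)). }
  exists (x, y). split; [split; assumption|].
  intros n Hn. specialize (Bx n Hn). specialize (By n Hn).
  eapply Rle_trans; [apply Cmod_2Rmax|].
  assert (B : (0 <= K * / INR (S n))%R).
  { apply Rmult_le_pos; [exact HK|]. left. apply Rinv_0_lt_compat, INR_S_pos. }
  apply Rmult_le_compat; [apply sqrt_pos | | |].
  - eapply Rle_trans; [apply Rabs_pos | apply Rmax_l].
  - replace 2%R with (sqrt 4) at 2; [apply sqrt_le_1_alt; lra|].
    replace 4%R with (2 * 2)%R by ring. apply sqrt_square. lra.
  - apply Rmax_lub; assumption.
Qed.

(** * Continuity of complex functions *)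

Lemma continuous_C_pair {U : UniformSpace} (f : U -> C) (x : U) :
  continuous (fun u => Re (f u)) x -> continuous (fun u => Im (f u)) x ->
  continuous (U := C_UniformSpace) f x.
Proof.
  intros H1 H2 P [eps HP].
  specialize (H1 _ (locally_ball (Re (f x)) eps)).
  specialize (H2 _ (locally_ball (Im (f x)) eps)).
  unfold filtermap in *.
  generalize (filter_and _ _ H1 H2). apply filter_imp.
  intros u [A B]. apply HP. split; assumption.
Qed.

Lemma continuous_Re {U : UniformSpace} (f : U -> C) (x : U) :
  continuous (U := C_UniformSpace) f x -> continuous (fun u => Re (f u)) x.
Proof.
  intros H P [eps HP]. specialize (H _ (locally_ball (f x) eps)). revert H.
  unfold filtermap. apply filter_imp. intros u [A B]. apply HP. exact A.
Qed.

Lemma continuous_Im {U : UniformSpace} (f : U -> C) (x : U) :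
  continuous (U := C_UniformSpace) f x -> continuous (fun u => Im (f u)) x.
Proof.
  intros H P [eps HP]. specialize (H _ (locally_ball (f x) eps)). revert H.
  unfold filtermap. apply filter_imp. intros u [A B]. apply HP. exact B.
Qed.

Lemma continuous_Cplus {U : UniformSpace} (f g : U -> C) (x : U) :
  continuous (U := C_UniformSpace) f x -> continuous (U := C_UniformSpace) g x ->
  continuous (U := C_UniformSpace) (fun u => f u + g u) x.
Proof.
  intros Hf Hg. apply continuous_C_pair; simpl.
  - apply (continuous_plus (V := R_NormedModule)); apply continuous_Re; assumption.
  - apply (continuous_plus (V := R_NormedModule)); apply continuous_Im; assumption.
Qed.

Lemma continuous_Copp {U : UniformSpace} (f : U -> C) (x : U) :
  continuous (U := C_UniformSpace) f x ->
  continuous (U := C_UniformSpace) (fun u => - f u) x.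
Proof.
  intros Hf. apply continuous_C_pair; simpl.
  - apply (continuous_opp (V := R_NormedModule)); apply continuous_Re; assumption.
  - apply (continuous_opp (V := R_NormedModule)); apply continuous_Im; assumption.
Qed.

Lemma continuous_Cmult {U : UniformSpace} (f g : U -> C) (x : U) :
  continuous (U := C_UniformSpace) f x -> continuous (U := C_UniformSpace) g x ->
  continuous (U := C_UniformSpace) (fun u => f u * g u) x.
Proof.
  intros Hf Hg.
  pose proof (continuous_Re _ _ Hf). pose proof (continuous_Im _ _ Hf).
  pose proof (continuous_Re _ _ Hg). pose proof (continuous_Im _ _ Hg).
  apply continuous_C_pair; simpl.
  - apply (continuous_minus (V := R_NormedModule)); apply (continuous_mult (K := R_AbsRing)); assumption.
  - apply (continuous_plus (V := R_NormedModule)); apply (continuous_mult (K := R_AbsRing)); assumption.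
Qed.

Lemma Cmod2_neq_0 (z : C) : z <> 0 -> (Re z ^ 2 + Im z ^ 2)%R <> 0%R.
Proof.
  intros Hz E. apply Hz. destruct z as [a b]. simpl in *.
  assert (a = 0%R) by nra. assert (b = 0%R) by nra. subst. reflexivity.
Qed.

Lemma continuous_Cinv {U : UniformSpace} (f : U -> C) (x : U) :
  continuous (U := C_UniformSpace) f x -> f x <> 0 ->
  continuous (U := C_UniformSpace) (fun u => / f u) x.
Proof.
  intros Hf Hx.
  pose proof (continuous_Re _ _ Hf) as Hr. pose proof (continuous_Im _ _ Hf) as Hi.
  pose proof (Cmod2_neq_0 _ Hx) as N.
  assert (D : continuous (fun u => (/ (Re (f u) ^ 2 + Im (f u) ^ 2))%R) x).
  { apply (continuous_comp (fun u => (Re (f u) ^ 2 + Im (f u) ^ 2)%R) Rinv).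
    - simpl. apply (continuous_plus (V := R_NormedModule));
      repeat (apply (continuous_mult (K := R_AbsRing)); try assumption);
      apply continuous_const.
    - apply continuous_Rinv. exact N. }
  apply continuous_C_pair; simpl.
  - apply (continuous_mult (K := R_AbsRing)); assumption.
  - apply (continuous_mult (K := R_AbsRing)); [|assumption].
    apply (continuous_opp (V := R_NormedModule)); assumption.
Qed.

Lemma continuous_Cpow {U : UniformSpace} (f : U -> C) (x : U) (n : nat) :
  continuous (U := C_UniformSpace) f x ->
  continuous (U := C_UniformSpace) (fun u => f u ^ n) x.
Proof.
  intros Hf. induction n as [|n IH]; simpl.
  - apply continuous_const.
  - apply continuous_Cmult; assumption.
Qed.

Lemma continuous_RtoC {U : UniformSpace} (f : U -> R) (x : U) :
  continuous f x -> continuous (U := C_UniformSpace) (fun u => RtoC (f u)) x.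
Proof. intros H. apply continuous_C_pair; simpl; [exact H | apply continuous_const]. Qed.

Lemma continuous_zsum {U : UniformSpace} (N : nat) (F : Z -> U -> C) (x : U) :
  (forall m, continuous (U := C_UniformSpace) (F m) x) ->
  continuous (U := C_UniformSpace) (fun u => zsum N (fun m => F m u)) x.
Proof.
  intros H. induction N as [|N IH].
  - apply (continuous_ext (F 0%Z)); [intro u; symmetry; apply zsum_0 | apply H].
  - apply (continuous_ext (fun u => F (- Z.of_nat (S N))%Z u + zsum N (fun m => F m u) + F (Z.of_nat (S N)) u)).
    + intro u. symmetry. apply zsum_S.
    + apply continuous_Cplus; [apply continuous_Cplus; [apply H | exact IH] | apply H].
Qed.

(** The neighbourhoods of the plane are boxes; this is the criterion with discs. *)
Lemma continuous_C_eps (f : C -> C) (z : C) :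
  continuous (T := C_UniformSpace) (U := C_UniformSpace) f z <->
  forall eps : R, (0 < eps)%R -> exists delta : R, (0 < delta)%R /\
    forall w, (Cmod (w - z) < delta)%R -> (Cmod (f w - f z) < eps)%R.
Proof.
  assert (s2 : (0 < sqrt 2)%R) by (apply sqrt_lt_R0; lra).
  split.
  - intros H eps He.
    assert (He' : (0 < eps / sqrt 2)%R) by (apply Rdiv_lt_0_compat; assumption).
    destruct (H _ (locally_ball (f z) (mkposreal _ He'))) as [d Hd].
    exists d. split; [apply cond_pos|].
    intros w Hw. specialize (Hd w (C_NormedModule_mixin_compat1 _ _ _ Hw)).
    apply C_NormedModule_mixin_compat2 in Hd. simpl in Hd.
    replace (sqrt 2 * (eps / sqrt 2))%R with eps in Hd by (field; lra). exact Hd.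
  - intros H P [eps HP].
    destruct (H eps (cond_pos eps)) as [d [Hd Hw]].
    assert (Hd' : (0 < d / sqrt 2)%R) by (apply Rdiv_lt_0_compat; assumption).
    exists (mkposreal _ Hd'). intros w B.
    apply HP. apply C_NormedModule_mixin_compat1. apply Hw.
    apply C_NormedModule_mixin_compat2 in B. simpl in B.
    replace (sqrt 2 * (d / sqrt 2))%R with d in B by (field; lra). exact B.
Qed.

(** * Convergence and continuity of the Weierstrass function *)

(** In a rectangular lattice the modulus dominates each of the two coordinates. *)
Lemma Cmod_rect_lattice_ge (w1 b x y D r : R) :
  (0 <= D)%R -> (D <= w1)%R -> (D <= b)%R -> (r <= Rabs x \/ r <= Rabs y)%R -> (0 <= r)%R ->
  (r * D <= Cmod (RtoC x * RtoC w1 + RtoC y * (0%R, b)))%R.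
Proof.
  intros HD H1 H2 H Hr. destruct H as [H|H].
  - eapply Rle_trans; [|apply re_le_Cmod]. simpl.
    replace (x * w1 - 0 * 0 + (y * 0 - 0 * b))%R with (x * w1)%R by ring.
    rewrite Rabs_mult, (Rabs_pos_eq w1) by lra. apply Rmult_le_compat; assumption.
  - eapply Rle_trans; [|apply Im_le_Cmod]. simpl.
    replace (x * 0 + 0 * w1 + (y * b + 0 * 0))%R with (y * b)%R by ring.
    rewrite Rabs_mult, (Rabs_pos_eq b) by lra. apply Rmult_le_compat; assumption.
Qed.

(** The lattice point [2 m w1 + 2 n w2], [w1] and [w2] being half-periods. *)
Definition lattice_point (w1 w2 : C) (m n : Z) : C := RtoC (2 * IZR m) * w1 + RtoC (2 * IZR n) * w2.

Lemma lattice_point_ge (w1 b D : R) (m n : Z) (N : nat) :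
  (0 <= D)%R -> (D <= w1)%R -> (D <= b)%R ->
  Z.max (Z.abs m) (Z.abs n) = Z.of_nat N ->
  (2 * INR N * D <= Cmod (lattice_point w1 (0%R, b) m n))%R.
Proof.
  intros HD H1 H2 H. apply Cmod_rect_lattice_ge; try assumption.
  - rewrite !Rabs_mult, (Rabs_pos_eq 2) by lra. rewrite <- !abs_IZR, INR_IZR_INZ.
    assert (E : (Z.abs m = Z.of_nat N \/ Z.abs n = Z.of_nat N)%Z) by lia.
    destruct E as [E|E]; rewrite E.
    + left. lra.
    + right. lra.
  - pose proof (pos_INR N). lra.
Qed.

(** The terms of the series of [wp] are [O(|w|^-3)], uniformly for bounded [z]. *)
Lemma lattice_term_bound (z w : C) (M : R) :
  (Cmod z <= M)%R -> (0 < Cmod w)%R -> (2 * M <= Cmod w)%R ->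
  (Cmod (/ (z - w) ^ 2 - / w ^ 2) <= 10 * M / Cmod w ^ 3)%R.
Proof.
  intros Hz Hw HM.
  assert (w0 : w <> 0) by (intro E; rewrite E, Cmod_0 in Hw; lra).
  assert (zw : (Cmod w / 2 <= Cmod (z - w))%R).
  { pose proof (Cmod_triangle z (- (z - w))) as T. rewrite Cmod_opp in T.
    replace (z + - (z - w)) with w in T by ring. lra. }
  assert (zw0 : z - w <> 0) by (intro E; rewrite E, Cmod_0 in zw; lra).
  replace (/ (z - w) ^ 2 - / w ^ 2) with (z * (w + (w - z)) / ((z - w) ^ 2 * w ^ 2))
    by (field; split; assumption).
  assert (nz : (z - w) ^ 2 * w ^ 2 <> 0) by (apply Cmult_neq_0; apply Cpow_nz; assumption).
  rewrite Cmod_div by exact nz. rewrite !Cmod_mult, !Cmod_pow.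
  assert (T : (Cmod (w + (w - z)) <= 5 / 2 * Cmod w)%R).
  { eapply Rle_trans; [apply Cmod_triangle|].
    pose proof (Cmod_triangle w (- z)) as T. rewrite Cmod_opp in T.
    change (w + - z) with (w - z) in T. lra. }
  set (W := Cmod w) in *. pose proof (Cmod_ge_0 z). pose proof (Cmod_ge_0 (w + (w - z))).
  set (X := Cmod (z - w)) in *. set (Y := Cmod (w + (w - z))) in *. set (V := Cmod z) in *.
  assert (0 < X)%R by lra.
  assert (A1 : (V * Y <= M * (5 / 2 * W))%R) by (apply Rmult_le_compat; assumption).
  assert (A2 : (/ (X ^ 2 * W ^ 2) <= / ((W / 2) ^ 2 * W ^ 2))%R).
  { apply Rinv_le_contravar.
    - apply Rmult_lt_0_compat; apply pow_lt; lra.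
    - apply Rmult_le_compat_r; [apply pow_le; lra|]. apply pow_incr. lra. }
  replace (10 * M / W ^ 3)%R with ((M * (5 / 2 * W)) * / ((W / 2) ^ 2 * W ^ 2))%R by (field; lra).
  unfold Rdiv. apply Rmult_le_compat; try assumption.
  - apply Rmult_le_pos; assumption.
  - left. apply Rinv_0_lt_compat, Rmult_lt_0_compat; apply pow_lt; lra.
Qed.

Lemma lattice_sum_box (w1 w2 z : C) (N : nat) :
  lattice_sum w1 w2 z N = box_sum N (lattice_term w1 w2 z).
Proof. reflexivity. Qed.

(** The square partial sums converge with a rate that is uniform on discs. No point has
    to be excluded: a term with a vanishing denominator has the value given by the
    convention [/ 0 = 0]. *)
Lemma lattice_sum_cv (w1 b M : R) :
  (0 < w1)%R -> (0 < b)%R -> (0 <= M)%R ->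
  exists K N0, forall z, (Cmod z <= M)%R -> exists l,
    Clim_seq (lattice_sum w1 (0%R, b) z) l /\
    forall n, (N0 <= n)%nat -> (Cmod (lattice_sum w1 (0%R, b) z n - l) <= 2 * (K * / INR (S n)))%R.
Proof.
  intros H1 Hb HM.
  set (D := Rmin w1 b).
  assert (D0 : (0 < D)%R) by (apply Rmin_pos; assumption).
  assert (D1 : (D <= w1)%R) by apply Rmin_l. assert (D2 : (D <= b)%R) by apply Rmin_r.
  destruct (nfloor_ex (M / D)) as [N0 [_ HN0]].
  { apply Rdiv_le_0_compat; assumption. }
  exists (20 * M / D ^ 3)%R, N0. intros z Hz.
  apply telescoping_cv. intros n Hn.
  pose proof (INR_S_pos n) as Sn.
  assert (Hn' : (M <= INR (S n) * D)%R).
  { apply Rmult_le_reg_r with (/ D)%R; [apply Rinv_0_lt_compat; exact D0|].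
    replace (INR (S n) * D * / D)%R with (INR (S n)) by (field; lra).
    apply le_INR in Hn. rewrite S_INR. unfold Rdiv in HN0. lra. }
  rewrite !lattice_sum_box.
  eapply Rle_trans.
  - apply box_sum_S_bound with (B := (10 * M / (2 * INR (S n) * D) ^ 3)%R).
    intros m k Hmk. unfold lattice_term.
    fold (lattice_point w1 (0%R, b) m k).
    replace (andb (m =? 0)%Z (k =? 0)%Z) with false.
    2: { symmetry. apply Bool.andb_false_iff. rewrite !Z.eqb_neq. lia. }
    pose proof (lattice_point_ge w1 b D m k (S n) (Rlt_le _ _ D0) D1 D2 Hmk) as L.
    assert (P : (0 < 2 * INR (S n) * D)%R) by nra.
    eapply Rle_trans; [apply lattice_term_bound with (M := M); [exact Hz | lra | lra]|].
    unfold Rdiv. apply Rmult_le_compat_l; [lra|].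
    apply Rinv_le_contravar; [apply pow_lt; exact P|]. apply pow_incr. lra.
  - rewrite (S_INR (S n)). set (x := INR (S n)) in *.
    assert (1 <= x)%R by (unfold x; rewrite S_INR; pose proof (pos_INR n); lra).
    replace (8 * x * (10 * M / (2 * x * D) ^ 3))%R with ((10 * M / D ^ 3) * / (x * x))%R
      by (field; lra).
    replace (20 * M / D ^ 3 * / (x * (x + 1)))%R with ((10 * M / D ^ 3) * (2 * / (x * (x + 1))))%R
      by (field; lra).
    apply Rmult_le_compat_l.
    + apply Rdiv_le_0_compat; [lra | apply pow_lt; exact D0].
    + replace (2 * / (x * (x + 1)))%R with (/ (x * (x + 1) / 2))%R by (field; lra).
      apply Rinv_le_contravar; nra.
Qed.

Lemma wp_cv (w1 b : R) (z : C) :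
  (0 < w1)%R -> (0 < b)%R ->
  Clim_seq (fun N => / z ^ 2 + lattice_sum w1 (0%R, b) z N) (wp w1 (0%R, b) z).
Proof.
  intros H1 Hb.
  destruct (lattice_sum_cv w1 b (Cmod z) H1 Hb (Cmod_ge_0 z)) as [K [N0 H]].
  destruct (H z (Rle_refl _)) as [l [Hl _]].
  unfold wp. rewrite (Clim_seq_Lim _ _ Hl).
  apply Clim_seq_plus; [apply Clim_seq_const | exact Hl].
Qed.

Lemma continuous_lattice_term (w1 w2 z : C) (m n : Z) :
  z <> lattice_point w1 w2 m n ->
  continuous (T := C_UniformSpace) (U := C_UniformSpace)
    (fun u => lattice_term w1 w2 u m n) z.
Proof.
  intros Hz. unfold lattice_term. fold (lattice_point w1 w2 m n).
  destruct (andb _ _); [apply continuous_const|].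
  unfold Cminus at 1. apply continuous_Cplus; [| apply continuous_const].
  apply continuous_Cinv.
  - apply continuous_Cpow. apply continuous_Cplus; [apply continuous_id | apply continuous_const].
  - apply Cpow_nz. intro E. apply Hz.
    replace z with (z - lattice_point w1 w2 m n + lattice_point w1 w2 m n) by ring. rewrite E. ring.
Qed.

Lemma continuous_wp (w1 b : R) (p : C) :
  (0 < w1)%R -> (0 < b)%R -> (forall m n, p <> lattice_point w1 (0%R, b) m n) ->
  continuous (T := C_UniformSpace) (U := C_UniformSpace) (wp w1 (0%R, b)) p.
Proof.
  intros H1 Hb Hp.
  unfold wp. apply continuous_Cplus.
  { apply continuous_Cinv; [apply continuous_Cpow, continuous_id|].
    apply Cpow_nz. intro E. apply (Hp 0%Z 0%Z). rewrite E. unfold lattice_point.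
    rewrite Rmult_0_r. ring. }
  apply continuous_C_eps. intros eps He.
  destruct (lattice_sum_cv w1 b (Cmod p + 1) H1 Hb) as [K [N0 HK]].
  { pose proof (Cmod_ge_0 p). lra. }
  pose proof (is_lim_seq_inv_S (2 * K)) as L. apply is_lim_seq_spec in L.
  destruct (L (mkposreal (eps / 3) ltac:(lra))) as [N1 HN1]. simpl in HN1.
  set (N := Nat.max N0 N1).
  assert (T : forall z, (Cmod z <= Cmod p + 1)%R -> exists l,
     ((real (Lim_seq (fun n => Re (lattice_sum w1 (0%R, b) z n))),
       real (Lim_seq (fun n => Im (lattice_sum w1 (0%R, b) z n)))) : C) = l /\
     (Cmod (lattice_sum w1 (0%R, b) z N - l) < eps / 3)%R).
  { intros z Hz. destruct (HK z Hz) as [l [Hl Bl]]. exists l.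
    split; [apply Clim_seq_Lim; exact Hl|].
    eapply Rle_lt_trans; [apply Bl; unfold N; lia|].
    specialize (HN1 N ltac:(unfold N; lia)). rewrite Rminus_0_r in HN1.
    eapply Rle_lt_trans; [apply Rle_abs|]. rewrite <- Rmult_assoc. exact HN1. }
  assert (CS : continuous (T := C_UniformSpace) (U := C_UniformSpace)
                 (fun z => lattice_sum w1 (0%R, b) z N) p).
  { apply (continuous_zsum N (fun m z => zsum N (lattice_term w1 (0%R, b) z m))).
    intro m. apply (continuous_zsum N (fun n z => lattice_term w1 (0%R, b) z m n)).
    intro n. apply continuous_lattice_term, Hp. }
  apply continuous_C_eps with (eps := (eps / 3)%R) in CS; [|lra].
  destruct CS as [d [Hd CS]].
  exists (Rmin d 1). split; [apply Rmin_pos; lra|].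
  intros w Hw.
  assert (Hw1 : (Cmod (w - p) < d)%R) by (eapply Rlt_le_trans; [exact Hw | apply Rmin_l]).
  assert (Hw2 : (Cmod (w - p) < 1)%R) by (eapply Rlt_le_trans; [exact Hw | apply Rmin_r]).
  specialize (CS w Hw1).
  destruct (T w) as [lw [Ew Bw]].
  { replace w with (p + (w - p)) by ring. pose proof (Cmod_triangle p (w - p)). lra. }
  destruct (T p) as [lp [Ep Bp]]; [lra|].
  rewrite Ew, Ep. set (sw := lattice_sum w1 (0%R, b) w N) in *.
  set (sp := lattice_sum w1 (0%R, b) p N) in *.
  replace (lw - lp) with (- (sw - lw) + ((sw - sp) + (sp - lp))) by ring.
  pose proof (Cmod_triangle (- (sw - lw)) ((sw - sp) + (sp - lp))).
  pose proof (Cmod_triangle (sw - sp) (sp - lp)).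
  rewrite Cmod_opp in H. lra.
Qed.

(** * The Eisenstein series of weight 2 summed over squares *)

Lemma Cmod_ge_neq_0 (z : C) (r : R) : (0 < r)%R -> (r <= Cmod z)%R -> z <> 0.
Proof. intros Hr H E. rewrite E, Cmod_0 in H. lra. Qed.

(** Partial fractions for the terms [1 / (h^2 - c^2 / 4)], [h] running along an arithmetic
    progression of step [c]; adding the next two terms turns [q] into [q + 1]. *)
Lemma telescope_step (a c q : C) :
  a + q * c <> 0 -> a - q * c <> 0 -> a + (q + 1) * c <> 0 -> a - (q + 1) * c <> 0 ->
  / ((a - q * c) * (a - (q + 1) * c)) + 2 * q / ((a + q * c) * (a - q * c))
    + / ((a + q * c) * (a + (q + 1) * c))
  = 2 * (q + 1) / ((a + (q + 1) * c) * (a - (q + 1) * c)).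
Proof. intros. field. repeat split; assumption. Qed.

Lemma zsum_telescope (a c : C) (M : nat) :
  (forall y : R, a + RtoC y * c <> 0) ->
  zsum M (fun l => / ((a + RtoC (IZR l) * c) ^ 2 - c ^ 2 / 4)) =
  2 * RtoC (INR M + / 2) / (a ^ 2 - RtoC (INR M + / 2) ^ 2 * c ^ 2).
Proof.
  intros H.
  assert (H' : forall y : R, a - RtoC y * c <> 0).
  { intros y. replace (a - RtoC y * c) with (a + RtoC (- y) * c); [apply H|].
    rewrite RtoC_opp. ring. }
  assert (F : forall y : R, a ^ 2 - RtoC y ^ 2 * c ^ 2
                            = (a + RtoC y * c) * (a - RtoC y * c)) by (intro; ring).
  rewrite F.
  induction M as [|M IH].
  - rewrite zsum_0. simpl INR. rewrite Rplus_0_l.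
    replace ((a + RtoC 0 * c) ^ 2 - c ^ 2 / 4)
      with ((a + RtoC (/ 2) * c) * (a - RtoC (/ 2) * c))
      by (rewrite RtoC_inv by lra; field).
    replace (2 * RtoC (/ 2)) with (RtoC 1); [field; split; auto|].
    rewrite <- RtoC_mult. f_equal. field.
  - rewrite zsum_S, IH.
    rewrite opp_IZR, <- INR_IZR_INZ, S_INR.
    assert (Eq : RtoC (INR M + 1 + / 2) = RtoC (INR M + / 2) + 1)
      by (rewrite <- RtoC_plus; f_equal; ring).
    assert (E1 : RtoC (INR M + 1) = RtoC (INR M + / 2) + / 2)
      by (rewrite <- RtoC_inv by lra; rewrite <- RtoC_plus; f_equal; field).
    pose proof (H (INR M + / 2)%R) as P1. pose proof (H' (INR M + / 2)%R) as P2.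
    pose proof (H (INR M + 1 + / 2)%R) as P3. pose proof (H' (INR M + 1 + / 2)%R) as P4.
    rewrite RtoC_opp. rewrite Eq in *. rewrite E1. set (q := RtoC (INR M + / 2)) in *.
    rewrite <- telescope_step by assumption.
    replace ((a + - (q + / 2) * c) ^ 2 - c ^ 2 / 4)
      with ((a - q * c) * (a - (q + 1) * c)) by field.
    replace ((a + (q + / 2) * c) ^ 2 - c ^ 2 / 4)
      with ((a + q * c) * (a + (q + 1) * c)) by field.
    reflexivity.
Qed.

(** The sum of [1 / h^2] along a side of the lattice square is compared with the
    telescoping sum of [1 / (h^2 - c^2 / 4)]. *)
Lemma line_sum_bound (a c : C) (rho : R) (M : nat) :
  (0 < rho)%R -> (forall y : R, (rho <= Cmod (a + RtoC y * c))%R) ->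
  (Cmod (zsum M (fun l => / (a + RtoC (IZR l) * c) ^ 2)%C
         - 2 * RtoC (INR M + / 2) / (a ^ 2 - RtoC (INR M + / 2) ^ 2 * c ^ 2))
   <= (2 * INR M + 1) * (Cmod c ^ 2 / (4 * rho ^ 4)))%R.
Proof.
  intros Hr H.
  assert (N : forall y : R, a + RtoC y * c <> 0)
    by (intro y; apply Cmod_ge_neq_0 with rho; auto).
  rewrite <- zsum_telescope by exact N. rewrite <- zsum_minus.
  apply zsum_bound. intros m _.
  pose proof (H (IZR m)) as B0. pose proof (H (IZR m + / 2)%R) as B1.
  pose proof (H (IZR m - / 2)%R) as B2.
  pose proof (N (IZR m)) as N0. pose proof (N (IZR m + / 2)%R) as N1.
  pose proof (N (IZR m - / 2)%R) as N2.
  set (h := a + RtoC (IZR m) * c) in *.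
  replace (h ^ 2 - c ^ 2 / 4)
    with ((a + RtoC (IZR m + / 2) * c) * (a + RtoC (IZR m - / 2) * c))
    by (unfold h; rewrite RtoC_plus, RtoC_minus, RtoC_inv by lra; field).
  set (h1 := a + RtoC (IZR m + / 2) * c) in *.
  set (h2 := a + RtoC (IZR m - / 2) * c) in *.
  assert (E : / h ^ 2 - / (h1 * h2) = - (c ^ 2 / 4) / (h ^ 2 * (h1 * h2))).
  { replace (- (c ^ 2 / 4)) with (h1 * h2 - h ^ 2)
      by (unfold h, h1, h2; rewrite RtoC_plus, RtoC_minus, RtoC_inv by lra; field).
    field. repeat split; assumption. }
  rewrite E, Cmod_div 
    by (apply Cmult_neq_0; [apply Cpow_nz | apply Cmult_neq_0]; assumption).
  rewrite Cmod_opp, Cmod_div by (intro E4; injection E4; lra).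
  rewrite !Cmod_mult, !Cmod_pow, (Cmod_R 4), Rabs_pos_eq by lra.
  replace (Cmod c ^ 2 / (4 * rho ^ 4))%R with (Cmod c ^ 2 / 4 * / rho ^ 4)%R by (field; lra).
  unfold Rdiv at 1. apply Rmult_le_compat_l.
  - apply Rmult_le_pos; [apply pow_le, Cmod_ge_0 | lra].
  - apply Rinv_le_contravar; [apply pow_lt; exact Hr|].
    replace (rho ^ 4)%R with (rho ^ 2 * (rho * rho))%R by ring.
    apply Rmult_le_compat; [apply pow_le; lra | nra | apply pow_incr; lra|].
    apply Rmult_le_compat; lra.
Qed.

(** The term [1 / h^2] of the Eisenstein series of weight 2, at the point [h = k x + l y];
    its value at [h = 0] is 0. *)
Definition invsq (x y : C) (k l : Z) : C := / (RtoC (IZR k) * x + RtoC (IZR l) * y) ^ 2.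

Lemma invsq_opp (x y : C) (k l : Z) : invsq x y (- k) (- l) = invsq x y k l.
Proof.
  unfold invsq. rewrite !opp_IZR, !RtoC_opp. f_equal. ring.
Qed.

(** The telescoped contributions of a vertical and of a horizontal side of the square of
    size [x] cancel up to a small error. Here [A] and [B] are the squares of the sides
    of a lattice cell. *)
Lemma ring_sum_main_bound (A B x : R) :
  (0 < A)%R -> (0 < B)%R -> (1 <= x)%R ->
  (Rabs ((2 * x + 1) / (x ^ 2 * A + (x + / 2) ^ 2 * B)
     - (2 * x - 1) / ((x - / 2) ^ 2 * A + x ^ 2 * B)) <= 8 * / (A + B) * / (x * (x + 1)))%R.
Proof.
  intros HA HB Hx.
  assert (P1 : (x ^ 2 * (A + B) <= x ^ 2 * A + (x + / 2) ^ 2 * B)%R).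
  { assert (x ^ 2 <= (x + / 2) ^ 2)%R by (apply pow_incr; lra). nra. }
  assert (P2 : (x ^ 2 / 4 * (A + B) <= (x - / 2) ^ 2 * A + x ^ 2 * B)%R).
  { replace (x ^ 2 / 4)%R with ((x / 2) ^ 2)%R by field.
    assert ((x / 2) ^ 2 <= (x - / 2) ^ 2)%R by (apply pow_incr; lra).
    assert ((x / 2) ^ 2 <= x ^ 2)%R by (apply pow_incr; lra). nra. }
  set (D1 := (x ^ 2 * A + (x + / 2) ^ 2 * B)%R) in *.
  set (D2 := ((x - / 2) ^ 2 * A + x ^ 2 * B)%R) in *.
  assert (Q1 : (0 < x ^ 2 * (A + B))%R)
    by (apply Rmult_lt_0_compat; [apply pow_lt|]; lra).
  assert (Q2 : (0 < x ^ 2 / 4 * (A + B))%R)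
    by (pose proof (pow_lt x 2 ltac:(lra)); apply Rmult_lt_0_compat; lra).
  replace ((2 * x + 1) / D1 - (2 * x - 1) / D2)%R
    with (((/ 4 - x / 2) * A + (x / 2 + / 4) * B) * / (D1 * D2))%R.
  2: { field_simplify_eq; [unfold D1, D2; field | lra]. }
  rewrite Rabs_mult, (Rabs_pos_eq (/ (D1 * D2))).
  2: { left. apply Rinv_0_lt_compat, Rmult_lt_0_compat; lra. }
  assert (N : (Rabs ((/ 4 - x / 2) * A + (x / 2 + / 4) * B) <= x * (A + B))%R).
  { apply Rabs_le. split; nra. }
  apply Rle_trans with (x * (A + B) * / (x ^ 2 * (A + B) * (x ^ 2 / 4 * (A + B))))%R.
  - apply Rmult_le_compat; [apply Rabs_pos | | exact N |].
    + left. apply Rinv_0_lt_compat, Rmult_lt_0_compat; lra.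
    + apply Rinv_le_contravar; [apply Rmult_lt_0_compat; assumption|].
      apply Rmult_le_compat; lra.
  - replace (x * (A + B) * / (x ^ 2 * (A + B) * (x ^ 2 / 4 * (A + B))))%R
      with (/ (A + B) * (8 * / (2 * (x * (x * x)))))%R by (field; lra).
    replace (8 * / (A + B) * / (x * (x + 1)))%R
      with (/ (A + B) * (8 * / (x * (x + 1))))%R by (field; lra).
    apply Rmult_le_compat_l; [left; apply Rinv_0_lt_compat; lra|].
    apply Rmult_le_compat_l; [lra|].
    apply Rinv_le_contravar; nra.
Qed.

(** The Eisenstein series of weight 2 of a rectangular lattice converges when it is summed
    over squares, although it does not converge absolutely. *)
Lemma invsq_box_cv (a b : R) :
  (0 < a)%R -> (0 < b)%R ->
  exists l, Clim_seq (fun N => box_sum N (invsq a (0%R, b))) l.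
Proof.
  intros Ha Hb.
  set (c := (0%R, b) : C).
  assert (Cc : Cmod c = b).
  { unfold c, Cmod. simpl. replace (0 * (0 * 1) + b * (b * 1))%R with (b * b)%R by ring.
    apply sqrt_square. lra. }
  assert (Ca : Cmod a = a) by (rewrite Cmod_R; apply Rabs_pos_eq; lra).
  assert (c2 : c ^ 2 = RtoC (- b ^ 2)).
  { unfold c. unfold RtoC. simpl. unfold Cmult. simpl. f_equal; ring. }
  assert (a2 : RtoC a ^ 2 = RtoC (a ^ 2)) by (symmetry; apply RtoC_pow).
  set (K := (3 * b ^ 2 / (2 * a ^ 4) + 3 * a ^ 2 / (2 * b ^ 4))%R).
  (* [K] collects the errors of the four sides, the other constant their main terms. *)
  destruct (telescoping_cv (fun N => box_sum N (invsq a c))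
              (2 * (8 * / (a ^ 2 + b ^ 2)) + 4 * K) 0) as [l [Hl _]].
  2: { exists l. exact Hl. }
  intros n _.
  rewrite box_sum_S.
  rewrite <- (zsum_opp_index (S n) (invsq a c (- Z.of_nat (S n))%Z)).
  rewrite (zsum_ext (S n) (fun m => invsq a c (- Z.of_nat (S n)) (- m)) (invsq a c (Z.of_nat (S n))))
    by (intros; apply invsq_opp).
  rewrite <- (zsum_opp_index n (fun m => invsq a c m (- Z.of_nat (S n))%Z)).
  rewrite (zsum_ext n (fun m => invsq a c (- m) (- Z.of_nat (S n)))
             (fun m => invsq a c m (Z.of_nat (S n)))) by (intros; apply invsq_opp).
  set (x := INR (S n)).
  assert (Hx : (1 <= x)%R) by (unfold x; rewrite S_INR; pose proof (pos_INR n); lra).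
  assert (V : (Cmod (zsum (S n) (invsq a c (Z.of_nat (S n)))
               - 2 * RtoC (x + / 2) / (RtoC x ^ 2 * RtoC a ^ 2 - RtoC (x + / 2) ^ 2 * c ^ 2))
            <= (2 * x + 1) * (b ^ 2 / (4 * (x * a) ^ 4)))%R).
  { replace (RtoC x ^ 2 * RtoC a ^ 2) with ((RtoC x * RtoC a) ^ 2) by ring.
    rewrite <- Cc at 1. unfold invsq. rewrite <- INR_IZR_INZ. fold x.
    apply (line_sum_bound (RtoC x * RtoC a) c (x * a) (S n)); [nra|].
    intro y. eapply Rle_trans; [|apply re_le_Cmod]. simpl.
    rewrite Rabs_pos_eq by nra. apply Req_le. ring. }
  assert (H : (Cmod (zsum n (fun m => invsq a c m (Z.of_nat (S n)))
               - 2 * RtoC (x - / 2) / (RtoC x ^ 2 * c ^ 2 - RtoC (x - / 2) ^ 2 * RtoC a ^ 2))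
            <= (2 * x - 1) * (a ^ 2 / (4 * (x * b) ^ 4)))%R).
  { replace (RtoC x ^ 2 * c ^ 2) with ((RtoC x * c) ^ 2) by ring.
    replace (a ^ 2 / (4 * (x * b) ^ 4))%R with (Cmod a ^ 2 / (4 * (x * b) ^ 4))%R
      by (rewrite Ca; reflexivity).
    assert (E : (x - / 2)%R = (INR n + / 2)%R) by (unfold x; rewrite S_INR; field).
    assert (E' : (2 * x - 1)%R = (2 * INR n + 1)%R) by (unfold x; rewrite S_INR; ring).
    rewrite E, E'.
    rewrite (zsum_ext n _ (fun m => / (RtoC x * c + RtoC (IZR m) * RtoC a) ^ 2)).
    2: { intros m _. unfold invsq. rewrite <- INR_IZR_INZ. fold x. f_equal. ring. }
    apply (line_sum_bound (RtoC x * c) a (x * b) n); [nra|].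
    intro y. eapply Rle_trans; [|apply Im_le_Cmod]. simpl.
    rewrite Rabs_pos_eq by nra. apply Req_le. ring. }
  set (v := zsum (S n) (invsq a c (Z.of_nat (S n)))) in *.
  set (h := zsum n (fun m => invsq a c m (Z.of_nat (S n)))) in *.
  assert (MT : (Cmod (2 * RtoC (x + / 2) / (RtoC x ^ 2 * RtoC a ^ 2 - RtoC (x + / 2) ^ 2 * c ^ 2)
      + 2 * RtoC (x - / 2) / (RtoC x ^ 2 * c ^ 2 - RtoC (x - / 2) ^ 2 * RtoC a ^ 2))
      <= 8 * / (a ^ 2 + b ^ 2) * / (x * (x + 1)))%R).
  { pose proof (ring_sum_main_bound (a ^ 2) (b ^ 2) x ltac:(nra) ltac:(nra) Hx) as Z.
    assert (P1 : (0 < x ^ 2 * a ^ 2 + (x + / 2) ^ 2 * b ^ 2)%R) by (apply Rplus_lt_0_compat; apply Rmult_lt_0_compat; apply pow_lt; lra).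
    assert (P2 : (0 < (x - / 2) ^ 2 * a ^ 2 + x ^ 2 * b ^ 2)%R) by (apply Rplus_lt_0_compat; apply Rmult_lt_0_compat; apply pow_lt; lra).
    rewrite c2, a2, <- !RtoC_pow, <- !RtoC_mult, <- !RtoC_minus.
    rewrite <- !RtoC_div by nra.
    rewrite <- RtoC_plus, Cmod_R.
    eapply Rle_trans; [|exact Z]. apply Req_le. f_equal. field. nra. }
  rewrite (S_INR (S n)). fold x.
  replace (box_sum n (invsq a c) + (v + v) + (h + h) - box_sum n (invsq a c))
    with (2 * ((2 * RtoC (x + / 2) / (RtoC x ^ 2 * RtoC a ^ 2 - RtoC (x + / 2) ^ 2 * c ^ 2)
      + 2 * RtoC (x - / 2) / (RtoC x ^ 2 * c ^ 2 - RtoC (x - / 2) ^ 2 * RtoC a ^ 2))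
      + ((v - 2 * RtoC (x + / 2) / (RtoC x ^ 2 * RtoC a ^ 2 - RtoC (x + / 2) ^ 2 * c ^ 2))
      + (h - 2 * RtoC (x - / 2) / (RtoC x ^ 2 * c ^ 2 - RtoC (x - / 2) ^ 2 * RtoC a ^ 2)))))
    by ring.
  set (m1 := 2 * RtoC (x + / 2) / (RtoC x ^ 2 * RtoC a ^ 2 - RtoC (x + / 2) ^ 2 * c ^ 2)) in *.
  set (m2 := 2 * RtoC (x - / 2) / (RtoC x ^ 2 * c ^ 2 - RtoC (x - / 2) ^ 2 * RtoC a ^ 2)) in *.
  rewrite Cmod_mult, (Cmod_R 2), Rabs_pos_eq by lra.
  pose proof (Cmod_triangle (m1 + m2) ((v - m1) + (h - m2))).
  pose proof (Cmod_triangle (v - m1) (h - m2)).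
  assert (BK : ((2 * x + 1) * (b ^ 2 / (4 * (x * a) ^ 4)) + (2 * x - 1) * (a ^ 2 / (4 * (x * b) ^ 4))
           <= 2 * K * / (x * (x + 1)))%R).
  { assert (I : (/ (x * (x * x)) <= 2 * / (x * (x + 1)))%R).
    { replace (2 * / (x * (x + 1)))%R with (/ (x * (x + 1) / 2))%R by (field; lra).
      apply Rinv_le_contravar; nra. }
    apply Rle_trans with (K * / (x * (x * x)))%R.
    - replace (b ^ 2 / (4 * (x * a) ^ 4))%R with (b ^ 2 / (4 * a ^ 4) * (/ x * / (x * (x * x))))%R by (field; lra).
      replace (a ^ 2 / (4 * (x * b) ^ 4))%R with (a ^ 2 / (4 * b ^ 4) * (/ x * / (x * (x * x))))%R by (field; lra).
      set (k1 := (b ^ 2 / (4 * a ^ 4))%R). set (k2 := (a ^ 2 / (4 * b ^ 4))%R).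
      assert (0 < k1)%R by (apply Rdiv_lt_0_compat; [nra | pose proof (pow_lt a 4 Ha); lra]).
      assert (0 < k2)%R by (apply Rdiv_lt_0_compat; [nra | pose proof (pow_lt b 4 Hb); lra]).
      replace K with (6 * k1 + 6 * k2)%R by (unfold K, k1, k2; field; lra).
      set (i3 := (/ (x * (x * x)))%R).
      assert (0 < i3)%R by (apply Rinv_0_lt_compat; nra).
      replace ((2 * x + 1) * (k1 * (/ x * i3)) + (2 * x - 1) * (k2 * (/ x * i3)))%R
        with ((k1 * (2 + / x) + k2 * (2 - / x)) * i3)%R by (field; lra).
      assert (0 < / x <= 1)%R.
      { split; [apply Rinv_0_lt_compat; lra|]. rewrite <- Rinv_1. apply Rinv_le_contravar; lra. }
      apply Rmult_le_compat_r; [lra|]. nra.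
    - replace (2 * K * / (x * (x + 1)))%R with (K * (2 * / (x * (x + 1))))%R by ring.
      apply Rmult_le_compat_l; [|exact I].
      unfold K. pose proof (pow_lt a 4 Ha). pose proof (pow_lt b 4 Hb).
      apply Rplus_le_le_0_compat; apply Rdiv_le_0_compat; nra. }
  set (J := (/ (x * (x + 1)))%R) in *. nra.
Qed.

(** * The points of order 4 *)

(** Sum of [F m] over the integers [-N <= m <= N + 1], the range covered by complete sets
    of residues modulo 2 or 4. *)
Definition ezsum (N : nat) (F : Z -> C) : C := zsum N F + F (Z.of_nat (S N)).
(** Sum of [F m n] over the square [-N <= m, n <= N + 1]. *)
Definition ebox_sum (N : nat) (F : Z -> Z -> C) : C := ezsum N (fun m => ezsum N (F m)).

Lemma Cinv_0 : / (RtoC 0) = 0.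
Proof. unfold Cinv, RtoC. simpl. f_equal; unfold Rdiv; ring. Qed.

Lemma invsq_scale (x y : C) (c : Z) (k l : Z) : (c <> 0)%Z ->
  invsq x y (c * k) (c * l) = / RtoC (IZR c) ^ 2 * invsq x y k l.
Proof.
  intros Hc. unfold invsq. rewrite !mult_IZR, !RtoC_mult.
  assert (c0 : RtoC (IZR c) <> 0).
  { intro E. apply RtoC_inj in E. apply eq_IZR in E. contradiction. }
  replace (RtoC (IZR c) * RtoC (IZR k) * x + RtoC (IZR c) * RtoC (IZR l) * y)
    with (RtoC (IZR c) * (RtoC (IZR k) * x + RtoC (IZR l) * y)) by ring.
  destruct (Ceq_dec (RtoC (IZR k) * x + RtoC (IZR l) * y) 0) as [E|E].
  - rewrite E. replace ((RtoC (IZR c) * 0) ^ 2) with (RtoC 0) by ring.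
    replace ((RtoC 0) ^ 2) with (RtoC 0) by ring. rewrite Cinv_0. ring.
  - field. split; assumption.
Qed.

Lemma zsum_mod4 (N : nat) (f : Z -> C) :
  zsum N (fun m => f (-1 - 4 * m)%Z + f (0 - 4 * m)%Z + f (1 - 4 * m)%Z + f (2 - 4 * m)%Z)
  = ezsum (4 * N + 1) f.
Proof.
  unfold ezsum. induction N as [|N IH].
  - rewrite zsum_0. simpl Nat.add. rewrite zsum_S, zsum_0. simpl. ring.
  - rewrite zsum_S, IH.
    replace (4 * S N + 1)%nat with (S (S (S (S (4 * N + 1))))) by lia.
    rewrite !zsum_S.
    set (M := Z.of_nat N).
    replace (Z.of_nat (S (4 * N + 1))) with (4 * M + 2)%Z by lia.
    replace (Z.of_nat (S (S (4 * N + 1)))) with (4 * M + 3)%Z by lia.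
    replace (Z.of_nat (S (S (S (4 * N + 1))))) with (4 * M + 4)%Z by lia.
    replace (Z.of_nat (S (S (S (S (4 * N + 1)))))) with (4 * M + 5)%Z by lia.
    replace (Z.of_nat (S (S (S (S (S (4 * N + 1))))))) with (4 * M + 6)%Z by lia.
    replace (-1 - 4 * - Z.of_nat (S N))%Z with (4 * M + 3)%Z by lia.
    replace (0 - 4 * - Z.of_nat (S N))%Z with (4 * M + 4)%Z by lia.
    replace (1 - 4 * - Z.of_nat (S N))%Z with (4 * M + 5)%Z by lia.
    replace (2 - 4 * - Z.of_nat (S N))%Z with (4 * M + 6)%Z by lia.
    replace (-1 - 4 * Z.of_nat (S N))%Z with (- (4 * M + 5))%Z by lia.
    replace (0 - 4 * Z.of_nat (S N))%Z with (- (4 * M + 4))%Z by lia.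
    replace (1 - 4 * Z.of_nat (S N))%Z with (- (4 * M + 3))%Z by lia.
    replace (2 - 4 * Z.of_nat (S N))%Z with (- (4 * M + 2))%Z by lia.
    ring.
Qed.

Lemma zsum_mod2 (N : nat) (f : Z -> C) :
  zsum N (fun m => f (0 - 4 * m)%Z + f (2 - 4 * m)%Z) = ezsum (2 * N) (fun k => f (2 * k)%Z).
Proof.
  unfold ezsum. induction N as [|N IH].
  - rewrite zsum_0. simpl Nat.mul. rewrite zsum_0. reflexivity.
  - rewrite zsum_S, IH.
    replace (2 * S N)%nat with (S (S (2 * N))) by lia.
    rewrite !zsum_S.
    set (M := Z.of_nat N).
    replace (2 * Z.of_nat (S (2 * N)))%Z with (4 * M + 2)%Z by lia.
    replace (2 * Z.of_nat (S (S (2 * N))))%Z with (4 * M + 4)%Z by lia.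
    replace (2 * Z.of_nat (S (S (S (2 * N)))))%Z with (4 * M + 6)%Z by lia.
    replace (2 * - Z.of_nat (S (2 * N)))%Z with (- (4 * M + 2))%Z by lia.
    replace (2 * - Z.of_nat (S (S (2 * N))))%Z with (- (4 * M + 4))%Z by lia.
    replace (0 - 4 * - Z.of_nat (S N))%Z with (4 * M + 4)%Z by lia.
    replace (2 - 4 * - Z.of_nat (S N))%Z with (4 * M + 6)%Z by lia.
    replace (0 - 4 * Z.of_nat (S N))%Z with (- (4 * M + 4))%Z by lia.
    replace (2 - 4 * Z.of_nat (S N))%Z with (- (4 * M + 2))%Z by lia.
    ring.
Qed.

(** Sum of [F] over the part of the coset [(i, j) + 4 Z^2] indexed by a square. *)
Definition coset_sum (F : Z -> Z -> C) (N : nat) (i j : Z) : C :=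
  box_sum N (fun m n => F (i - 4 * m)%Z (j - 4 * n)%Z).

Lemma ezsum_ext (N : nat) (F G : Z -> C) : (forall m, F m = G m) -> ezsum N F = ezsum N G.
Proof. intros H. unfold ezsum. rewrite H. f_equal. apply zsum_ext. auto. Qed.

Lemma ebox_sum_mod4 (N : nat) (F : Z -> Z -> C) :
  ebox_sum (4 * N + 1) F =
  let row i := coset_sum F N i (-1) + coset_sum F N i 0 + coset_sum F N i 1 + coset_sum F N i 2 in
  row (-1)%Z + row 0%Z + row 1%Z + row 2%Z.
Proof.
  unfold ebox_sum.
  rewrite (ezsum_ext _ (fun m => ezsum (4 * N + 1) (F m)) (fun m => zsum N
     (fun n => F m (-1 - 4 * n)%Z + F m (0 - 4 * n)%Z + F m (1 - 4 * n)%Z + F m (2 - 4 * n)%Z)))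
    by (intro; symmetry; apply zsum_mod4).
  rewrite <- zsum_mod4. rewrite !zsum_plus.
  unfold coset_sum, box_sum. cbv zeta.
  assert (R : forall i, zsum N (fun m => zsum N (fun n =>
      F (i - 4 * m)%Z (-1 - 4 * n)%Z + F (i - 4 * m)%Z (0 - 4 * n)%Z
      + F (i - 4 * m)%Z (1 - 4 * n)%Z + F (i - 4 * m)%Z (2 - 4 * n)%Z)) =
    zsum N (fun m => zsum N (fun n => F (i - 4 * m)%Z (-1 - 4 * n)%Z))
    + zsum N (fun m => zsum N (fun n => F (i - 4 * m)%Z (0 - 4 * n)%Z))
    + zsum N (fun m => zsum N (fun n => F (i - 4 * m)%Z (1 - 4 * n)%Z))
    + zsum N (fun m => zsum N (fun n => F (i - 4 * m)%Z (2 - 4 * n)%Z))).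
  { intro i. rewrite <- !zsum_plus. apply zsum_ext. intros m _. rewrite <- !zsum_plus.
    reflexivity. }
  rewrite !R. reflexivity.
Qed.

Lemma ebox_sum_mod2 (N : nat) (F : Z -> Z -> C) :
  ebox_sum (2 * N) (fun k l => F (2 * k)%Z (2 * l)%Z) =
  coset_sum F N 0 0 + coset_sum F N 0 2 + coset_sum F N 2 0 + coset_sum F N 2 2.
Proof.
  unfold ebox_sum.
  rewrite (ezsum_ext _ _ (fun m => zsum N
     (fun n => F (2 * m)%Z (0 - 4 * n)%Z + F (2 * m)%Z (2 - 4 * n)%Z)))
    by (intro m; symmetry; apply (zsum_mod2 N (F (2 * m)%Z))).
  rewrite <- (zsum_mod2 N (fun m => zsum N (fun n => F m (0 - 4 * n)%Z + F m (2 - 4 * n)%Z))).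
  unfold coset_sum, box_sum.
  rewrite <- !zsum_plus. apply zsum_ext. intros m _. rewrite <- !zsum_plus.
  apply zsum_ext. intros n _. ring.
Qed.

Lemma invsq_bound_l (a b : R) (k l : Z) (N : nat) : (0 < a)%R ->
  Z.abs k = Z.of_nat (S N) ->
  (Cmod (invsq a (0%R, b) k l) <= / a ^ 2 * / INR (S N) ^ 2)%R.
Proof.
  intros Ha Hk. pose proof (INR_S_pos N) as P.
  assert (L : (a * INR (S N) <= Cmod (RtoC (IZR k) * a + RtoC (IZR l) * (0%R, b)))%R).
  { eapply Rle_trans; [|apply re_le_Cmod]. simpl.
    replace (IZR k * a - 0 * 0 + (IZR l * 0 - 0 * b))%R with (a * IZR k)%R by ring.
    rewrite Rabs_mult, (Rabs_pos_eq a), <- abs_IZR, Hk, <- INR_IZR_INZ by lra. apply Rle_refl. }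
  assert (P' : (0 < a * INR (S N))%R) by nra.
  unfold invsq. rewrite Cmod_inv.
  2: { apply Cpow_nz. apply Cmod_ge_neq_0 with (2 := L). exact P'. }
  rewrite Cmod_pow, <- Rinv_mult, <- Rpow_mult_distr.
  apply Rinv_le_contravar; [apply pow_lt; exact P'|]. apply pow_incr. lra.
Qed.

Lemma invsq_bound_r (a b : R) (k l : Z) (N : nat) : (0 < b)%R ->
  Z.abs l = Z.of_nat (S N) ->
  (Cmod (invsq a (0%R, b) k l) <= / b ^ 2 * / INR (S N) ^ 2)%R.
Proof.
  intros Hb Hl. pose proof (INR_S_pos N) as P.
  assert (L : (b * INR (S N) <= Cmod (RtoC (IZR k) * a + RtoC (IZR l) * (0%R, b)))%R).
  { eapply Rle_trans; [|apply Im_le_Cmod]. simpl.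
    replace (IZR k * 0 + 0 * a + (IZR l * b + 0 * 0))%R with (b * IZR l)%R by ring.
    rewrite Rabs_mult, (Rabs_pos_eq b), <- abs_IZR, Hl, <- INR_IZR_INZ by lra. apply Rle_refl. }
  assert (P' : (0 < b * INR (S N))%R) by nra.
  unfold invsq. rewrite Cmod_inv.
  2: { apply Cpow_nz. apply Cmod_ge_neq_0 with (2 := L). exact P'. }
  rewrite Cmod_pow, <- Rinv_mult, <- Rpow_mult_distr.
  apply Rinv_le_contravar; [apply pow_lt; exact P'|]. apply pow_incr. lra.
Qed.

(** The extra row and column contribute [O(1 / N)]. *)
Lemma invsq_ebox_cv (a b : R) (l : C) :
  (0 < a)%R -> (0 < b)%R ->
  Clim_seq (fun N => box_sum N (invsq a (0%R, b))) l ->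
  Clim_seq (fun N => ebox_sum N (invsq a (0%R, b))) l.
Proof.
  intros Ha Hb H.
  assert (D : Clim_seq (fun N => ebox_sum N (invsq a (0%R, b)) - box_sum N (invsq a (0%R, b))) 0).
  { apply Clim_seq_bound with (b := fun n => ((2 * (/ a ^ 2 + / b ^ 2)) * / INR (S n))%R) (N0 := 0%nat);
      [|apply is_lim_seq_inv_S].
    intros n _. unfold ebox_sum, ezsum. rewrite zsum_plus.
    change (zsum n (fun m => zsum n (invsq a (0%R, b) m))) with (box_sum n (invsq a (0%R, b))).
    set (c1 := zsum n (fun m => invsq a (0%R, b) m (Z.of_nat (S n)))).
    set (c2 := zsum n (invsq a (0%R, b) (Z.of_nat (S n)))).
    set (c3 := invsq a (0%R, b) (Z.of_nat (S n)) (Z.of_nat (S n))).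
    match goal with |- (Cmod ?e <= _)%R => replace e with (c1 + (c2 + c3)) by ring end.
    pose proof (Cmod_triangle c1 (c2 + c3)). pose proof (Cmod_triangle c2 c3).
    assert (B1 : (Cmod c1 <= (2 * INR n + 1) * (/ b ^ 2 * / INR (S n) ^ 2))%R)
      by (apply zsum_bound; intros; apply invsq_bound_r; [assumption | lia]).
    assert (B2 : (Cmod c2 <= (2 * INR n + 1) * (/ a ^ 2 * / INR (S n) ^ 2))%R)
      by (apply zsum_bound; intros; apply invsq_bound_l; [assumption | lia]).
    assert (B3 : (Cmod c3 <= / a ^ 2 * / INR (S n) ^ 2)%R)
      by (apply invsq_bound_l; [assumption | lia]).
    replace (/ INR (S n))%R with (INR (S n) * / INR (S n) ^ 2)%R
      by (pose proof (INR_S_pos n); field; lra).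
    assert (0 < / a ^ 2)%R by (apply Rinv_0_lt_compat, pow_lt; lra).
    assert (0 < / b ^ 2)%R by (apply Rinv_0_lt_compat, pow_lt; lra).
    assert (0 < / INR (S n) ^ 2)%R by (apply Rinv_0_lt_compat, pow_lt, INR_S_pos).
    replace (INR n) with (INR (S n) - 1)%R in B1, B2 by (rewrite S_INR; ring).
    pose proof (INR_S_pos n).
    set (u := (/ a ^ 2)%R) in *. set (v := (/ b ^ 2)%R) in *. set (w := (/ INR (S n) ^ 2)%R) in *.
    set (s := INR (S n)) in *.
    assert (0 < v * w)%R by nra. assert (0 < u * w)%R by nra. nra. }
  apply Clim_seq_ext with (fun N => box_sum N (invsq a (0%R, b))
     + (ebox_sum N (invsq a (0%R, b)) - box_sum N (invsq a (0%R, b)))); [intro; ring|].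
  replace l with (l + 0) by ring. apply Clim_seq_plus; assumption.
Qed.

Lemma zsum_only_0 (N : nat) (F : Z -> C) :
  (forall m, m <> 0%Z -> F m = 0) -> zsum N F = F 0%Z.
Proof.
  intros H. induction N as [|N IH]; [apply zsum_0|].
  rewrite zsum_S, IH, (H (- Z.of_nat (S N))%Z), (H (Z.of_nat (S N))) by lia. ring.
Qed.

(** A partial sum of [wp] at the quarter period [k a + l b i] is a coset sum of the
    Eisenstein terms of the finer lattice, minus a multiple of their full sum. *)
Lemma lattice_sum_coset (a b : R) (k l : Z) (N : nat) :
  let p := RtoC (IZR k) * a + RtoC (IZR l) * (0%R, b) in
  / p ^ 2 + lattice_sum (RtoC (2 * a)) (0%R, 2 * b)%R p N
  = coset_sum (invsq a (0%R, b)) N k l - / 16 * box_sum N (invsq a (0%R, b)).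
Proof.
  intros p. rewrite lattice_sum_box.
  assert (E : / p ^ 2 = box_sum N (fun m n =>
     if andb (m =? 0)%Z (n =? 0)%Z then / p ^ 2 else 0)).
  { unfold box_sum. rewrite zsum_only_0.
    - rewrite zsum_only_0; [reflexivity|].
      intros n Hn. apply Z.eqb_neq in Hn. rewrite Hn. reflexivity.
    - intros m Hm. rewrite zsum_only_0; apply Z.eqb_neq in Hm; intros; rewrite Hm; reflexivity. }
  rewrite E at 1. rewrite <- box_sum_plus, <- box_sum_scal.
  unfold coset_sum. rewrite <- box_sum_minus. apply box_sum_ext. intros m n.
  rewrite <- (Cmult_1_l (/ 16 * invsq _ _ m n)).
  replace (/ 16) with (/ RtoC (IZR 4) ^ 2).
  2: { f_equal. simpl. rewrite Cmult_1_r, <- RtoC_mult. f_equal. ring. }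
  rewrite <- invsq_scale by lia.
  assert (W : RtoC (2 * IZR m) * RtoC (2 * a) + RtoC (2 * IZR n) * (0%R, 2 * b)%R
     = RtoC (IZR (4 * m)) * a + RtoC (IZR (4 * n)) * (0%R, b)).
  { rewrite !mult_IZR. unfold RtoC, Cmult, Cplus. cbn [fst snd]. f_equal; ring. }
  unfold lattice_term. rewrite W.
  destruct (andb (m =? 0)%Z (n =? 0)%Z) eqn:D.
  - apply andb_prop in D. destruct D as [D1 D2]. apply Z.eqb_eq in D1, D2. subst m n.
    unfold invsq. rewrite !Z.mul_0_r, !Z.sub_0_r. fold p.
    replace ((0 * RtoC a + 0 * (0%R, b)) ^ 2) with (RtoC 0) by ring.
    rewrite Cinv_0. ring.
  - unfold invsq. rewrite !minus_IZR, !RtoC_minus. unfold p.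
    replace (RtoC (IZR k) * a + RtoC (IZR l) * (0%R, b) -
       (RtoC (IZR (4 * m)) * a + RtoC (IZR (4 * n)) * (0%R, b)))
     with ((RtoC (IZR k) - RtoC (IZR (4 * m))) * a + (RtoC (IZR l) - RtoC (IZR (4 * n))) * (0%R, b))
     by ring.
    ring.
Qed.

Lemma coset_sum_invsq_opp (x y : C) (N : nat) (i j : Z) :
  coset_sum (invsq x y) N (- i) (- j) = coset_sum (invsq x y) N i j.
Proof.
  unfold coset_sum. rewrite <- (box_sum_opp_index N (fun m n => invsq x y (i - 4 * m) (j - 4 * n))).
  apply box_sum_ext. intros m n. rewrite <- invsq_opp. f_equal; lia.
Qed.

(** The values of [wp] at the twelve points of exact order 4 add up to 0. By evenness the
    three values with coefficient 2 also account for the opposite points. After grouping by cosets the partial sum is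
    [G - G / 4 - 12 G / 16] in the limit, where [G] is the Eisenstein series of the
    lattice of quarter periods. *)
Theorem wp_four_torsion_sum (a b : R) : (0 < a)%R -> (0 < b)%R ->
  let P k l := wp (RtoC (2 * a)) (0%R, 2 * b)%R (RtoC (IZR k) * a + RtoC (IZR l) * (0%R, b)) in
  2 * P 1%Z 1%Z + 2 * P 1%Z (-1)%Z + 2 * P 1%Z 0%Z + P 1%Z 2%Z + P 1%Z (-2)%Z
  + P 2%Z 1%Z + P 2%Z (-1)%Z + P 0%Z 1%Z + P 0%Z (-1)%Z = 0.
Proof.
  intros Ha Hb P.
  destruct (invsq_box_cv a b Ha Hb) as [g Hg].
  set (F := invsq a (0%R, b)) in *.
  assert (HP : forall k l, Clim_seq (fun N => coset_sum F N k l - / 16 * box_sum N F) (P k l)).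
  { intros k l. eapply Clim_seq_ext; [|apply wp_cv; lra].
    intro N. apply lattice_sum_coset. }
  assert (HE : Clim_seq (fun N => ebox_sum N F) g) by (apply invsq_ebox_cv; assumption).
  assert (H4 : Clim_seq (fun N => ebox_sum (4 * N + 1) F) g)
    by (apply (Clim_seq_subseq (fun N => ebox_sum N F)); [intro; lia | exact HE]).
  assert (H2 : Clim_seq (fun N => ebox_sum (2 * N) F) g)
    by (apply (Clim_seq_subseq (fun N => ebox_sum N F)); [intro; lia | exact HE]).
  assert (S2 : forall N, ebox_sum (2 * N) (fun k l => F (2 * k)%Z (2 * l)%Z) = / 4 * ebox_sum (2 * N) F).
  { intro N. unfold ebox_sum, ezsum.
    assert (Z : forall M f, / 4 * zsum M f = zsum M (fun m => / 4 * f m)) by (intros; symmetry; apply zsum_scal).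
    assert (E : forall k l, F (2 * k)%Z (2 * l)%Z = / 4 * F k l).
    { intros k l. unfold F. rewrite invsq_scale by lia. f_equal. f_equal. simpl.
      ring. }
    rewrite !Cmult_plus_distr_l, !Z.
    f_equal; [|f_equal; [|apply E]].
    - apply zsum_ext. intros m _. rewrite Cmult_plus_distr_l, Z. f_equal; [|apply E].
      apply zsum_ext. intros n _. apply E.
    - apply zsum_ext. intros n _. apply E. }
  (* All pairs of residues modulo 4, minus those with two even entries, minus the
     constants [/ w ^ 2] of the twelve series. *)
  assert (L1 : Clim_seq (fun N => ebox_sum (4 * N + 1) F + (- / 4 * ebox_sum (2 * N) F
                 + - (3 / 4) * box_sum N F)) 0).
  { replace (RtoC 0) with (g + (- / 4 * g + - (3 / 4) * g)) by field.
    repeat apply Clim_seq_plus; try apply Clim_seq_scal; assumption. }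
  clearbody P.
  assert (L2 : Clim_seq (fun N => ebox_sum (4 * N + 1) F + (- / 4 * ebox_sum (2 * N) F
                 + - (3 / 4) * box_sum N F))
     (2 * P 1%Z 1%Z + 2 * P 1%Z (-1)%Z + 2 * P 1%Z 0%Z + P 1%Z 2%Z + P 1%Z (-2)%Z
      + P 2%Z 1%Z + P 2%Z (-1)%Z + P 0%Z 1%Z + P 0%Z (-1)%Z)).
  { eapply Clim_seq_ext.
    2: { repeat apply Clim_seq_plus; try apply Clim_seq_scal; apply HP. }
    intro N. cbv beta.
    pose proof (ebox_sum_mod4 N F) as M4. pose proof (ebox_sum_mod2 N F) as M2.
    rewrite S2 in M2. cbv beta zeta in M4.
    pose proof (coset_sum_invsq_opp a (0%R, b) N 1 1) as O1.
    pose proof (coset_sum_invsq_opp a (0%R, b) N 1 0) as O2.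
    pose proof (coset_sum_invsq_opp a (0%R, b) N 1 (-1)) as O3.
    pose proof (coset_sum_invsq_opp a (0%R, b) N 1 (-2)) as O4.
    fold F in O1, O2, O3, O4. simpl Z.opp in O1, O2, O3, O4.
    rewrite O1, O2, O3, O4 in M4. rewrite M4.
    replace (- / 4 * ebox_sum (2 * N) F) with (- (/ 4 * ebox_sum (2 * N) F)) by ring.
    rewrite M2. field. }
  apply (Clim_seq_unique _ _ _ L2 L1).
Qed.

(** * Derivatives along curves and the Schwarzian derivative *)

(** The curve [gam] has the velocity [v] at [x]. *)
Definition is_curve_derive (gam : R -> C) (x : R) (v : C) : Prop :=
  is_derive (fun y => Re (gam y)) x (Re v) /\ is_derive (fun y => Im (gam y)) x (Im v).

Lemma is_derive_eps (g : R -> R) (x l : R) :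
  is_derive g x l <->
  forall eps, (0 < eps)%R -> exists delta, (0 < delta)%R /\
    forall y, (Rabs (y - x) < delta)%R -> (Rabs (g y - g x - (y - x) * l) <= eps * Rabs (y - x))%R.
Proof.
  rewrite is_derive_Reals. split.
  - intros H eps He. destruct (H eps He) as [d Hd]. exists d. split; [apply cond_pos|].
    intros y Hy. destruct (Req_dec y x) as [E|E].
    + subst y. replace (g x - g x - (x - x) * l)%R with 0%R by ring.
      rewrite Rminus_diag, Rabs_R0. lra.
    + specialize (Hd (y - x)%R ltac:(lra) Hy).
      replace (x + (y - x))%R with y in Hd by ring.
      replace (g y - g x - (y - x) * l)%R with (((g y - g x) / (y - x) - l) * (y - x))%R
        by (field; lra).
      rewrite Rabs_mult. apply Rmult_le_compat_r; [apply Rabs_pos | lra].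
  - intros H eps He. destruct (H (eps / 2)%R ltac:(lra)) as [d [Hd Hy]].
    exists (mkposreal d Hd). intros h Hh0 Hh. simpl in Hh.
    specialize (Hy (x + h)%R). replace (x + h - x)%R with h in Hy by ring.
    specialize (Hy Hh).
    replace ((g (x + h) - g x) / h - l)%R with ((g (x + h) - g x - h * l) * / h)%R by (field; lra).
    rewrite Rabs_mult, Rabs_inv.
    assert (0 < Rabs h)%R by (apply Rabs_pos_lt; exact Hh0).
    apply Rle_lt_trans with (eps / 2 * Rabs h * / Rabs h)%R.
    + apply Rmult_le_compat_r; [left; apply Rinv_0_lt_compat; assumption | exact Hy].
    + replace (eps / 2 * Rabs h * / Rabs h)%R with (eps / 2)%R by (field; lra). lra.
Qed.

Lemma Cmod_le_sum (z : C) : (Cmod z <= Rabs (Re z) + Rabs (Im z))%R.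
Proof.
  replace z with (RtoC (Re z) + Ci * RtoC (Im z)) at 1.
  - eapply Rle_trans; [apply Cmod_triangle|].
    rewrite Cmod_mult, !Cmod_R. unfold Ci, Cmod at 1. simpl.
    replace (0 * (0 * 1) + 1 * (1 * 1))%R with 1%R by ring. rewrite sqrt_1. lra.
  - destruct z as [a b]. unfold Ci, RtoC, Cplus, Cmult. simpl. f_equal; ring.
Qed.

Lemma is_curve_derive_eps (gam : R -> C) (x : R) (v : C) :
  is_curve_derive gam x v <->
  forall eps, (0 < eps)%R -> exists delta, (0 < delta)%R /\
    forall y, (Rabs (y - x) < delta)%R ->
      (Cmod (gam y - gam x - RtoC (y - x) * v) <= eps * Rabs (y - x))%R.
Proof.
  assert (ER : forall y, Re (gam y - gam x - RtoC (y - x) * v)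
               = (Re (gam y) - Re (gam x) - (y - x) * Re v)%R).
  { intro y. destruct (gam y), (gam x), v. simpl. ring. }
  assert (EI : forall y, Im (gam y - gam x - RtoC (y - x) * v)
               = (Im (gam y) - Im (gam x) - (y - x) * Im v)%R).
  { intro y. destruct (gam y), (gam x), v. simpl. ring. }
  split.
  - intros [H1 H2] eps He.
    destruct (proj1 (is_derive_eps _ _ _) H1 (eps / 2)%R ltac:(lra)) as [d1 [P1 D1]].
    destruct (proj1 (is_derive_eps _ _ _) H2 (eps / 2)%R ltac:(lra)) as [d2 [P2 D2]].
    exists (Rmin d1 d2). split; [apply Rmin_pos; assumption|].
    intros y Hy. eapply Rle_trans; [apply Cmod_le_sum|]. rewrite ER, EI.
    specialize (D1 y (Rlt_le_trans _ _ _ Hy (Rmin_l _ _))).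
    specialize (D2 y (Rlt_le_trans _ _ _ Hy (Rmin_r _ _))). lra.
  - intros H. split; apply is_derive_eps; intros eps He;
      destruct (H eps He) as [d [P D]]; exists d; (split; [exact P|]);
      intros y Hy; (eapply Rle_trans; [|exact (D y Hy)]).
    + rewrite <- ER. apply re_le_Cmod.
    + rewrite <- EI. apply Im_le_Cmod.
Qed.

Lemma is_derive_C_eps (f : C -> C) (z l : C) :
  is_derive f z l ->
  forall eps, (0 < eps)%R -> exists delta, (0 < delta)%R /\
    forall w, (Cmod (w - z) < delta)%R -> (Cmod (f w - f z - (w - z) * l) <= eps * Cmod (w - z))%R.
Proof.
  intros [_ H] eps He.
  specialize (H z (fun P HP => HP) (mkposreal eps He)). simpl in H.
  apply locally_C in H. destruct H as [d Hd].
  exists d. split; [apply cond_pos|]. intros w Hw.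
  exact (Hd w (C_NormedModule_mixin_compat1 _ _ _ Hw)).
Qed.

Lemma curve_derive_comp (f : C -> C) (gam : R -> C) (x : R) (l v : C) :
  is_derive f (gam x) l -> is_curve_derive gam x v ->
  is_curve_derive (fun y => f (gam y)) x (l * v).
Proof.
  intros Hf Hg. apply is_curve_derive_eps. intros eps He.
  set (A := (Cmod l + 1)%R). set (B := (Cmod v + 1)%R).
  pose proof (Cmod_ge_0 l) as L0. pose proof (Cmod_ge_0 v) as V0.
  assert (A0 : (0 < A)%R) by (unfold A; lra). assert (B0 : (0 < B)%R) by (unfold B; lra).
  destruct (is_derive_C_eps _ _ _ Hf (eps / (2 * B))%R) as [d1 [P1 D1]].
  { apply Rdiv_lt_0_compat; lra. }
  rewrite is_curve_derive_eps in Hg.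
  destruct (Hg (Rmin 1 (eps / (2 * A)))) as [d2 [P2 D2]].
  { apply Rmin_pos; [lra | apply Rdiv_lt_0_compat; lra]. }
  exists (Rmin d2 (d1 / B)). split.
  { apply Rmin_pos; [assumption | apply Rdiv_lt_0_compat; assumption]. }
  intros y Hy.
  specialize (D2 y (Rlt_le_trans _ _ _ Hy (Rmin_l _ _))).
  assert (Hy2 : (Rabs (y - x) < d1 / B)%R) by (eapply Rlt_le_trans; [exact Hy | apply Rmin_r]).
  set (h := Rabs (y - x)) in *. assert (h0 : (0 <= h)%R) by apply Rabs_pos.
  set (r := gam y - gam x - RtoC (y - x) * v) in *.
  pose proof (Rmin_l 1 (eps / (2 * A))) as M1. pose proof (Rmin_r 1 (eps / (2 * A))) as M2.
  assert (R1 : (Cmod r <= h)%R) by nra.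
  assert (R2 : (Cmod r <= eps / (2 * A) * h)%R).
  { eapply Rle_trans; [exact D2|]. apply Rmult_le_compat_r; assumption. }
  assert (Eg : gam y - gam x = r + RtoC (y - x) * v) by (unfold r; ring).
  assert (G : (Cmod (gam y - gam x) <= B * h)%R).
  { rewrite Eg. eapply Rle_trans; [apply Cmod_triangle|].
    rewrite Cmod_mult, Cmod_R. fold h. unfold B. nra. }
  assert (G2 : (Cmod (gam y - gam x) < d1)%R).
  { eapply Rle_lt_trans; [exact G|]. apply Rlt_le_trans with (B * (d1 / B))%R.
    - apply Rmult_lt_compat_l; assumption.
    - apply Req_le. field. lra. }
  specialize (D1 _ G2).
  replace (f (gam y) - f (gam x) - RtoC (y - x) * (l * v))
    with ((f (gam y) - f (gam x) - (gam y - gam x) * l) + r * l) by (rewrite Eg; ring).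
  eapply Rle_trans; [apply Cmod_triangle|]. rewrite Cmod_mult.
  assert (T1 : (eps / (2 * B) * Cmod (gam y - gam x) <= eps / 2 * h)%R).
  { apply Rle_trans with (eps / (2 * B) * (B * h))%R.
    - apply Rmult_le_compat_l; [left; apply Rdiv_lt_0_compat; lra | exact G].
    - apply Req_le. field. lra. }
  assert (T2 : (Cmod r * Cmod l <= eps / 2 * h)%R).
  { apply Rle_trans with (eps / (2 * A) * h * A)%R.
    - apply Rmult_le_compat; [apply Cmod_ge_0 | exact L0 | exact R2 | unfold A; lra].
    - apply Req_le. field. lra. }
  lra.
Qed.

Lemma curve_derive_mult (g h : R -> C) (x : R) (u v : C) :
  is_curve_derive g x u -> is_curve_derive h x v ->
  is_curve_derive (fun y => g y * h y) x (u * h x + g x * v).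
Proof.
  intros [G1 G2] [H1 H2]. split.
  - replace (Re (u * h x + g x * v))
      with ((Re u * Re (h x) + Re (g x) * Re v) - (Im u * Im (h x) + Im (g x) * Im v))%R
      by (unfold Re, Im; simpl; ring).
    apply (is_derive_minus (V := R_NormedModule));
      apply (is_derive_mult (K := R_AbsRing)); auto using Rmult_comm.
  - replace (Im (u * h x + g x * v))
      with ((Re u * Im (h x) + Re (g x) * Im v) + (Im u * Re (h x) + Im (g x) * Re v))%R
      by (unfold Re, Im; simpl; ring).
    apply (is_derive_plus (V := R_NormedModule));
      apply (is_derive_mult (K := R_AbsRing)); auto using Rmult_comm.
Qed.

Lemma curve_derive_plus (g h : R -> C) (x : R) (u v : C) :
  is_curve_derive g x u -> is_curve_derive h x v ->
  is_curve_derive (fun y => g y + h y) x (u + v).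
Proof.
  intros [G1 G2] [H1 H2].
  split; apply (is_derive_plus (V := R_NormedModule)); assumption.
Qed.

Lemma curve_derive_const (c : C) (x : R) : is_curve_derive (fun _ => c) x 0.
Proof. split; apply (is_derive_const (V := R_NormedModule)). Qed.

Lemma curve_derive_RtoC (g : R -> R) (x v : R) :
  is_derive g x v -> is_curve_derive (fun y => RtoC (g y)) x v.
Proof. intros H. split; [exact H | exact (is_derive_const (V := R_NormedModule) 0%R x)]. Qed.

Lemma curve_derive_scal (c : C) (g : R -> C) (x : R) (u : C) :
  is_curve_derive g x u -> is_curve_derive (fun y => c * g y) x (c * u).
Proof.
  intros H. replace (c * u) with (0 * g x + c * u) by ring.
  apply (curve_derive_mult (fun _ => c)); [apply curve_derive_const | exact H].
Qed.

Lemma curve_derive_unique (g h : R -> C) (x : R) (u v : C) :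
  locally x (fun y => g y = h y) ->
  is_curve_derive g x u -> is_curve_derive h x v -> u = v.
Proof.
  intros E [G1 G2] [H1 H2].
  apply (is_derive_ext_loc _ (fun y => Re (h y))) in G1.
  2: { revert E. apply filter_imp. intros y Hy. rewrite Hy. reflexivity. }
  apply (is_derive_ext_loc _ (fun y => Im (h y))) in G2.
  2: { revert E. apply filter_imp. intros y Hy. rewrite Hy. reflexivity. }
  apply is_derive_unique in G1, G2, H1, H2.
  destruct u, v. simpl in *. f_equal; congruence.
Qed.

Lemma curve_derive_ext (g h : R -> C) (x : R) (u v : C) :
  (forall y, g y = h y) -> u = v -> is_curve_derive g x u -> is_curve_derive h x v.
Proof.
  intros E <- [G1 G2].
  split; (eapply is_derive_ext; [|eassumption]); intro y; simpl; rewrite E; reflexivity.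
Qed.

Lemma locally_Ioo (a b x : R) : (a < x < b)%R -> locally x (fun y => (a < y < b)%R).
Proof.
  intros H. apply (open_and _ _ (open_gt a) (open_lt b)). exact H.
Qed.

Lemma Cmult_integral_l (a b : C) : a <> 0 -> a * b = 0 -> b = 0.
Proof.
  intros Ha E. destruct (Ceq_dec b 0) as [Eb|Eb]; [exact Eb|].
  destruct (Cmult_neq_0 a b Ha Eb E).
Qed.

(** The chain rule for the Schwarzian derivative, for [f = g o (d F / 2)] on the segment
    [d x], [-1 < x < 1], where [F' = 1 / r] and [L] is the logarithmic derivative of [r].
    Only derivatives along the segment are used, so that the map relating the two domains
    need not be known to be holomorphic. *)
Lemma schwarzian_along_segment (Uf Ug : C -> Prop) (f g Sf Sg : C -> C) (d : C)
  (F r L L1 : R -> R) :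
  is_schwarzian_on Uf f Sf -> is_schwarzian_on Ug g Sg -> d <> 0 ->
  (forall x, (-1 < x < 1)%R -> Uf (d * RtoC x) /\ Ug (d * RtoC (F x) / 2)
     /\ f (d * RtoC x) = g (d * RtoC (F x) / 2)) ->
  (forall x, (-1 < x < 1)%R -> (0 < r x)%R /\ is_derive F x (/ r x)%R
     /\ is_derive r x (r x * L x)%R /\ is_derive L x (L1 x)) ->
  forall x, (-1 < x < 1)%R ->
    Sg (d * RtoC (F x) / 2) =
    4 * RtoC (r x) ^ 2 * (Sf (d * RtoC x) + RtoC (L1 x + L x ^ 2 / 2) / d ^ 2).
Proof.
  intros [f1 [f2 [Hf1 [Hf2 Hf3]]]] [g1 [g2 [Hg1 [Hg2 Hg3]]]] Hd HU HR.
  assert (z' : forall x, is_curve_derive (fun y => d * RtoC y) x d).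
  { intros x. eapply curve_derive_ext;
      [| |exact (curve_derive_scal d _ x _
                   (curve_derive_RtoC (fun y => y) x 1 (is_derive_id (K := R_AbsRing) x)))];
      [reflexivity | ring]. }
  assert (zeta' : forall x, (-1 < x < 1)%R ->
     is_curve_derive (fun y => d * RtoC (F y) / 2) x (d / (2 * RtoC (r x)))).
  { intros x Hx. destruct (HR x Hx) as [R0 [HF _]].
    eapply curve_derive_ext;
      [| |exact (curve_derive_scal (d / 2) _ x _ (curve_derive_RtoC F x _ HF))].
    - intro y. simpl. field.
    - rewrite RtoC_inv by lra. field. intro E. apply RtoC_inj in E. lra. }
  assert (r0 : forall x, (-1 < x < 1)%R -> RtoC (r x) <> 0).
  { intros x Hx E. apply RtoC_inj in E. destruct (HR x Hx) as [R0 _]. lra. }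
  (* The identity [f = g o (d F / 2)] on the segment is differentiated three times. *)
  assert (E1 : forall x, (-1 < x < 1)%R ->
     2 * RtoC (r x) * f1 (d * RtoC x) = g1 (d * RtoC (F x) / 2)).
  { intros x Hx. destruct (HU x Hx) as [U1 [U2 _]].
    assert (Q : f1 (d * RtoC x) * d = g1 (d * RtoC (F x) / 2) * (d / (2 * RtoC (r x)))).
    { apply (curve_derive_unique (fun y => f (d * RtoC y)) (fun y => g (d * RtoC (F y) / 2)) x).
      - generalize (locally_Ioo _ _ _ Hx). apply filter_imp. intros y Hy.
        apply HU. exact Hy.
      - apply (curve_derive_comp f (fun y => d * RtoC y)); [apply Hf1; exact U1 | apply z'].
      - apply (curve_derive_comp g (fun y => d * RtoC (F y) / 2)); [apply Hg1; exact U2 | apply zeta'; exact Hx]. }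
    specialize (r0 x Hx).
    assert (D : d * (2 * RtoC (r x) * f1 (d * RtoC x) - g1 (d * RtoC (F x) / 2)) = 0).
    { replace (d * (2 * RtoC (r x) * f1 (d * RtoC x) - g1 (d * RtoC (F x) / 2)))
        with (2 * RtoC (r x) * (f1 (d * RtoC x) * d) - d * g1 (d * RtoC (F x) / 2)) by ring.
      rewrite Q. field. exact r0. }
    apply (Cmult_integral_l _ _ Hd) in D.
    replace (2 * RtoC (r x) * f1 (d * RtoC x))
      with (2 * RtoC (r x) * f1 (d * RtoC x) - g1 (d * RtoC (F x) / 2) + g1 (d * RtoC (F x) / 2)) by ring.
    rewrite D. ring. }
  assert (E2 : forall x, (-1 < x < 1)%R ->
     RtoC (L x) + d * (f2 (d * RtoC x) / f1 (d * RtoC x))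
     = g2 (d * RtoC (F x) / 2) / g1 (d * RtoC (F x) / 2) * (d / (2 * RtoC (r x)))).
  { intros x Hx. destruct (HU x Hx) as [U1 [U2 _]]. destruct (HR x Hx) as [R0 [_ [Hr _]]].
    assert (Q : 2 * RtoC (r x * L x) * f1 (d * RtoC x) + 2 * RtoC (r x) * (f2 (d * RtoC x) * d)
              = g2 (d * RtoC (F x) / 2) * (d / (2 * RtoC (r x)))).
    { apply (curve_derive_unique (fun y => 2 * RtoC (r y) * f1 (d * RtoC y))
               (fun y => g1 (d * RtoC (F y) / 2)) x).
      - generalize (locally_Ioo _ _ _ Hx). apply filter_imp. exact E1.
      - apply (curve_derive_mult (fun y => 2 * RtoC (r y)) (fun y => f1 (d * RtoC y))).
        + apply curve_derive_scal, curve_derive_RtoC. exact Hr.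
        + apply (curve_derive_comp f1 (fun y => d * RtoC y)); [apply Hf2; exact U1 | apply z'].
      - apply (curve_derive_comp g1 (fun y => d * RtoC (F y) / 2)); [apply Hg2; exact U2 | apply zeta'; exact Hx]. }
    pose proof (proj2 (Hf1 _ U1)) as f10. specialize (r0 x Hx). rewrite RtoC_mult in Q.
    rewrite <- (E1 x Hx).
    replace (g2 (d * RtoC (F x) / 2) / (2 * RtoC (r x) * f1 (d * RtoC x)) * (d / (2 * RtoC (r x))))
      with (g2 (d * RtoC (F x) / 2) * (d / (2 * RtoC (r x))) / (2 * RtoC (r x) * f1 (d * RtoC x)))
      by (field; split; assumption).
    rewrite <- Q. field. split; assumption. }
  intros x Hx. destruct (HU x Hx) as [U1 [U2 _]].
  destruct (HR x Hx) as [R0 [_ [Hr HL]]].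
  destruct (Hf3 _ U1) as [lf [Hlf Sfe]]. destruct (Hg3 _ U2) as [lg [Hlg Sge]].
  specialize (r0 x Hx).
  assert (Q : RtoC (L1 x) + d * (lf * d)
     = lg * (d / (2 * RtoC (r x))) * (d / (2 * RtoC (r x)))
       + g2 (d * RtoC (F x) / 2) / g1 (d * RtoC (F x) / 2) * (d / 2 * RtoC (- (r x * L x) / r x ^ 2))).
  { apply (curve_derive_unique
       (fun y => RtoC (L y) + d * (f2 (d * RtoC y) / f1 (d * RtoC y)))
       (fun y => g2 (d * RtoC (F y) / 2) / g1 (d * RtoC (F y) / 2) * (d / 2 * RtoC (/ r y))) x).
    - generalize (locally_Ioo _ _ _ Hx). apply filter_imp. intros y Hy. rewrite (E2 y Hy).
      destruct (HR y Hy) as [Ry _].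
      f_equal. rewrite RtoC_inv by lra. field. intro E. apply RtoC_inj in E. lra.
    - apply curve_derive_plus; [apply curve_derive_RtoC; exact HL|].
      apply curve_derive_scal.
      apply (curve_derive_comp (fun w => f2 w / f1 w) (fun y => d * RtoC y)); [exact Hlf | apply z'].
    - replace (d / (2 * RtoC (r x))) with (d / 2 * RtoC (/ r x)) at 2
        by (rewrite RtoC_inv by lra; field; exact r0).
      apply (curve_derive_mult (fun y => g2 (d * RtoC (F y) / 2) / g1 (d * RtoC (F y) / 2))
               (fun y => d / 2 * RtoC (/ r y))).
      + apply (curve_derive_comp (fun w => g2 w / g1 w) (fun y => d * RtoC (F y) / 2));
          [exact Hlg | apply zeta'; exact Hx].
      + apply curve_derive_scal, curve_derive_RtoC. apply is_derive_inv; [exact Hr | lra]. }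
  rewrite Sfe, Sge. specialize (E2 x Hx).
  set (A := f2 (d * RtoC x) / f1 (d * RtoC x)) in *.
  set (B := g2 (d * RtoC (F x) / 2) / g1 (d * RtoC (F x) / 2)) in *.
  assert (EB : B = (RtoC (L x) + d * A) * (2 * RtoC (r x)) / d).
  { rewrite E2. field. split; assumption. }
  replace (- (r x * L x) / r x ^ 2)%R with (- L x / r x)%R in Q by (field; lra).
  rewrite RtoC_div, RtoC_opp in Q by lra.
  assert (Elg : lg = (RtoC (L1 x) + d * (lf * d) + B * (d / 2) * (RtoC (L x) / RtoC (r x)))
                      * (4 * RtoC (r x) ^ 2) / d ^ 2).
  { rewrite Q. field. split; assumption. }
  rewrite Elg, EB. rewrite RtoC_plus, RtoC_div, RtoC_pow by lra.
  field. split; assumption.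
Qed.

(** * The branch of the square root *)

Lemma Cconj_R (x : R) : Cconj (RtoC x) = RtoC x.
Proof. unfold Cconj, RtoC. simpl. f_equal. ring. Qed.

(** Two continuous square roots of the same nonvanishing function on [0, 1] that agree
    at 0 agree at 1, since their quotient takes its values in [{1, -1}]. *)
Lemma sqrt_branch_unique (a b : R -> C) :
  (forall x, (0 <= x <= 1)%R -> a x ^ 2 = b x ^ 2 /\ b x <> 0) ->
  (forall x, (0 <= x <= 1)%R -> continuous a x /\ continuous b x) ->
  a 0%R = b 0%R -> a 1%R = b 1%R.
Proof.
  intros Hsq Hc H0.
  set (q := fun x => a x / b x).
  assert (Hq : forall x, (0 <= x <= 1)%R -> q x = 1 \/ q x = - 1).
  { intros x Hx. destruct (Hsq x Hx) as [E N].
    assert (D : (a x - b x) * (a x + b x) = 0).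
    { replace ((a x - b x) * (a x + b x)) with (a x ^ 2 - b x ^ 2) by ring. rewrite E. ring. }
    unfold q. destruct (Ceq_dec (a x - b x) 0) as [Z|Z].
    - left. replace (a x) with (a x - b x + b x) by ring. rewrite Z. field. exact N.
    - right. apply (Cmult_integral_l _ _ Z) in D.
      replace (a x) with (a x + b x - b x) by ring. rewrite D. field. exact N. }
  assert (Cq : forall x, (0 <= x <= 1)%R -> continuous (fun y => Re (q y)) x).
  { intros x Hx. apply continuous_Re. destruct (Hc x Hx) as [Ca Cb].
    apply continuous_Cmult; [exact Ca | apply continuous_Cinv; [exact Cb | apply Hsq; exact Hx]]. }
  assert (q0 : q 0%R = 1).
  { unfold q. rewrite H0. field. apply Hsq. lra. }
  destruct (Hq 1%R ltac:(lra)) as [E|E].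
  { replace (a 1%R) with (q 1%R * b 1%R); [rewrite E; ring|].
    unfold q. field. apply Hsq. lra. }
  exfalso.
  assert (Lim : forall x, (0 <= x <= 1)%R -> is_lim (fun y => (- Re (q y))%R) x (- Re (q x))%R).
  { intros x Hx. apply (is_lim_continuity (fun y => (- Re (q y))%R) x).
    apply continuity_pt_opp.
    apply continuity_pt_filterlim. apply Cq. exact Hx. }
  (* The real part of the quotient would have to vanish somewhere. *)
  destruct (IVT_Rbar_incr (fun y => (- Re (q y))%R) 0%R 1%R (-1)%R 1%R 0%R) as [x [Hx1 [Hx2 Hx]]].
  - pose proof (Lim 0%R ltac:(lra)) as L. rewrite q0 in L. exact L.
  - pose proof (Lim 1%R ltac:(lra)) as L. rewrite E in L.
    replace (- Re (- 1))%R with 1%R in L by (simpl; ring). exact L.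
  - intros x Hx1 Hx2. simpl in Hx1, Hx2. apply continuity_pt_opp.
    apply continuity_pt_filterlim. apply Cq. lra.
  - simpl. lra.
  - simpl. lra.
  - simpl in Hx1, Hx2. destruct (Hq x ltac:(lra)) as [Z|Z]; rewrite Z in Hx; simpl in Hx; lra.
Qed.

(** A unit vector [d] on one of the two symmetry axes of the rectangle: [d] is one of
    1, -1, i, -i and [sg = d^2]. The map [z -> sg * conj z] is the reflection in the line
    through [d]. *)
Record is_direction (d : C) (sg : R) : Prop := {
  dir_sq : d * d = RtoC sg;
  dir_sg : (sg * sg = 1)%R;
  dir_conj : Cconj d = RtoC sg * d }.

Lemma direction_mod (d : C) (sg : R) : is_direction d sg -> Cmod d = 1%R.
Proof.
  intros [H1 H2 _].
  assert (E : (Cmod d * Cmod d = 1)%R).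
  { rewrite <- Cmod_mult, H1, Cmod_R.
    assert (Z : ((sg - 1) * (sg + 1) = 0)%R) by (ring_simplify; lra).
    apply Rmult_integral in Z. unfold Rabs. destruct (Rcase_abs sg); destruct Z; lra. }
  pose proof (Cmod_ge_0 d). nra.
Qed.

Lemma direction_neq_0 (d : C) (sg : R) : is_direction d sg -> d <> 0.
Proof. intros H E. apply direction_mod in H. rewrite E, Cmod_0 in H. lra. Qed.

Lemma RtoC_sg (d : C) (sg : R) : is_direction d sg -> RtoC sg * RtoC sg = 1.
Proof. intros [_ H _]. rewrite <- RtoC_mult, H. reflexivity. Qed.

(** The product under the root in the elliptic integral is an even real quartic. *)
Lemma expi_factors (t : R) (w : C) :
  (w - expi t) * (w + expi (- t)) * (w + expi t) * (w - expi (- t))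
  = w ^ 4 - RtoC (2 * cos (2 * t)) * w ^ 2 + 1.
Proof.
  assert (E1 : expi t * expi (- t) = 1).
  { unfold expi. rewrite cos_neg, sin_neg. unfold Cmult, RtoC. simpl.
    pose proof (sin2_cos2 t) as T. unfold Rsqr in T. f_equal; [lra | ring]. }
  assert (E2 : expi t + expi (- t) = RtoC (2 * cos t)).
  { unfold expi. rewrite cos_neg, sin_neg. unfold Cplus, RtoC. simpl. f_equal; ring. }
  assert (E3 : RtoC (2 * cos (2 * t)) = expi t ^ 2 + expi (- t) ^ 2).
  { replace (expi t ^ 2 + expi (- t) ^ 2)
      with ((expi t + expi (- t)) ^ 2 - 2 * (expi t * expi (- t))) by ring.
    rewrite E1, E2, cos_2a_cos, <- RtoC_pow, Cmult_1_r, <- RtoC_minus. f_equal. ring. }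
  rewrite E3.
  replace ((w - expi t) * (w + expi (- t)) * (w + expi t) * (w - expi (- t)))
    with (w ^ 4 - (expi t ^ 2 + expi (- t) ^ 2) * w ^ 2 + (expi t * expi (- t)) ^ 2) by ring.
  rewrite E1. ring.
Qed.

Lemma expi_mod (t : R) : Cmod (expi t) = 1%R.
Proof.
  unfold expi, Cmod. simpl. pose proof (sin2_cos2 t) as T. unfold Rsqr in T.
  replace (cos t * (cos t * 1) + sin t * (sin t * 1))%R with 1%R by lra. apply sqrt_1.
Qed.

Lemma Cminus_neq_0 (w e : C) : unit_disk w -> Cmod e = 1%R -> w - e <> 0.
Proof.
  unfold unit_disk. intros Hw He E.
  replace w with (w - e + e) in Hw by ring. rewrite E, Cplus_0_l in Hw. lra.
Qed.

Lemma branch_sq (t : R) (s : C -> C) (Hs : is_sqrt_branch t s) (w : C) : unit_disk w ->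
  s w ^ 2 = w ^ 4 - RtoC (2 * cos (2 * t)) * w ^ 2 + 1.
Proof. intros Hw. rewrite <- expi_factors. apply (proj1 Hs). exact Hw. Qed.

Lemma branch_neq_0 (t : R) (s : C -> C) (Hs : is_sqrt_branch t s) (w : C) : unit_disk w -> s w <> 0.
Proof.
  intros Hw E. pose proof (proj1 Hs w Hw) as H. rewrite E in H.
  assert (N : (w - expi t) * (w + expi (- t)) * (w + expi t) * (w - expi (- t)) <> 0).
  { assert (P : forall u, w + expi u <> 0).
    { intro u. replace (w + expi u) with (w - (- expi u)) by ring.
      apply Cminus_neq_0; [exact Hw|]. rewrite Cmod_opp. apply expi_mod. }
    repeat apply Cmult_neq_0; try apply P; apply Cminus_neq_0; auto using expi_mod. }
  apply N. rewrite <- H. ring.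
Qed.

Lemma branch_continuous_ray (t : R) (s : C -> C) (Hs : is_sqrt_branch t s) (z : C) (x : R) : unit_disk (RtoC x * z) ->
  continuous (fun y : R => s (RtoC y * z)) x.
Proof.
  intros H. apply (continuous_comp (fun y : R => RtoC y * z) s).
  - apply continuous_Cmult; [apply continuous_RtoC, continuous_id | apply continuous_const].
  - apply (proj1 (proj2 Hs)). exact H.
Qed.

Lemma unit_disk_ray (z : C) (x : R) : unit_disk z -> (0 <= x <= 1)%R -> unit_disk (RtoC x * z).
Proof.
  unfold unit_disk. intros Hz Hx. rewrite Cmod_mult, Cmod_R, Rabs_pos_eq by lra.
  pose proof (Cmod_ge_0 z). nra.
Qed.

Lemma branch_reflect (t : R) (s : C -> C) (Hs : is_sqrt_branch t s)
  (d : C) (sg : R) (z : C) : is_direction d sg -> unit_disk z ->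
  s (RtoC sg * Cconj z) = Cconj (s z).
Proof.
  intros Hd Hz.
  pose proof (RtoC_sg _ _ Hd) as S2.
  assert (Hz' : unit_disk (RtoC sg * Cconj z)).
  { unfold unit_disk in *. rewrite <- (Cmod_conj z) in Hz. rewrite Cmod_mult.
    replace (RtoC sg) with (d * d) by apply Hd.
    rewrite Cmod_mult, (direction_mod _ _ Hd). lra. }
  pose proof (sqrt_branch_unique (fun x => s (RtoC x * (RtoC sg * Cconj z)))
                (fun x => Cconj (s (RtoC x * z)))) as H.
  cbv beta in H. rewrite !Cmult_1_l in H. apply H.
  - intros x Hx. pose proof (unit_disk_ray z x Hz Hx) as U1.
    pose proof (unit_disk_ray _ x Hz' Hx) as U2. split.
    + rewrite (branch_sq t s Hs) by exact U2.
      replace (Cconj (s (RtoC x * z)) ^ 2) with (Cconj (s (RtoC x * z) ^ 2))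
        by apply Cpow_conj.
      rewrite (branch_sq t s Hs) by exact U1.
      rewrite Cplus_conj, Cminus_conj, Cmult_conj, !Cpow_conj, Cmult_conj, !Cconj_R.
      set (c := RtoC (2 * cos (2 * t))). set (w := Cconj z). set (g := RtoC sg) in *.
      replace ((RtoC x * (g * w)) ^ 4) with ((g * g) * (g * g) * (RtoC x * w) ^ 4) by ring.
      replace ((RtoC x * (g * w)) ^ 2) with ((g * g) * (RtoC x * w) ^ 2) by ring.
      rewrite S2. ring.
    + intro E. apply (branch_neq_0 t s Hs _ U1).
      rewrite <- (Cconj_conj (s (RtoC x * z))), E. apply Cconj_R.
  - intros x Hx. split.
    + apply (branch_continuous_ray t s Hs), unit_disk_ray; assumption.
    + pose proof (branch_continuous_ray t s Hs z x (unit_disk_ray _ _ Hz Hx)) as C.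
      apply continuous_C_pair; simpl.
      * apply continuous_Re in C. exact C.
      * apply continuous_Im in C. apply (continuous_opp (V := R_NormedModule)). exact C.
  - rewrite !Cmult_0_l, (proj2 (proj2 Hs)), Cconj_R. reflexivity.
Qed.

(** * The elliptic integral on the axes of symmetry *)

(** The values on the line through [d] of the quartic under the root of the elliptic
    integral, with [k = d^2 cos 2t]. *)
Definition quartic (k x : R) : R := (x ^ 4 - 2 * k * x ^ 2 + 1)%R.

(** The elliptic integral along the line through [d], divided by [d]. *)
Definition ray_integral (k x : R) : R := RInt (fun u => (/ sqrt (quartic k u))%R) 0 x.

Lemma quartic_pos (k x : R) : (-1 < k < 1)%R -> (0 < quartic k x)%R.
Proof.
  intros Hk. unfold quartic.
  replace (x ^ 4 - 2 * k * x ^ 2 + 1)%R with ((x ^ 2 - k) ^ 2 + (1 - k) * (1 + k))%R by ring.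
  assert (0 < (1 - k) * (1 + k))%R by nra. pose proof (pow2_ge_0 (x ^ 2 - k)). lra.
Qed.

Lemma is_derive_quartic (k x : R) : is_derive (quartic k) x (4 * x ^ 3 - 4 * k * x)%R.
Proof. unfold quartic. auto_derive; [exact I | ring]. Qed.

(** The derivative is written as the function times its logarithmic derivative. *)
Lemma is_derive_sqrt_quartic (k x : R) : (-1 < k < 1)%R ->
  is_derive (fun y => sqrt (quartic k y)) x
    (sqrt (quartic k x) * ((2 * x ^ 3 - 2 * k * x) / quartic k x))%R.
Proof.
  intros Hk. pose proof (quartic_pos k x Hk) as P.
  pose proof (sqrt_lt_R0 _ P) as S.
  replace (sqrt (quartic k x) * ((2 * x ^ 3 - 2 * k * x) / quartic k x))%R
    with ((4 * x ^ 3 - 4 * k * x) / (2 * sqrt (quartic k x)))%R.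
  - apply is_derive_sqrt; [apply is_derive_quartic | exact P].
  - replace (quartic k x) with (sqrt (quartic k x) * sqrt (quartic k x))%R at 3
      by (apply sqrt_sqrt; lra).
    field. lra.
Qed.

Lemma is_derive_log_sqrt_quartic (k x : R) : (-1 < k < 1)%R ->
  is_derive (fun y => (2 * y ^ 3 - 2 * k * y) / quartic k y)%R x
    ((6 * x ^ 2 - 2 * k) / quartic k x - 2 * ((2 * x ^ 3 - 2 * k * x) / quartic k x) ^ 2)%R.
Proof.
  intros Hk. pose proof (quartic_pos k x Hk) as P. unfold quartic in *.
  auto_derive; [lra | field; lra].
Qed.

Lemma continuous_inv_sqrt_quartic (k x : R) : (-1 < k < 1)%R ->
  continuous (fun u => (/ sqrt (quartic k u))%R) x.
Proof.
  intros Hk. apply (continuous_comp (fun u => sqrt (quartic k u)) Rinv).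
  - apply @ex_derive_continuous.
    eexists. apply is_derive_sqrt_quartic. exact Hk.
  - apply continuous_Rinv. pose proof (sqrt_lt_R0 _ (quartic_pos k x Hk)). lra.
Qed.

Lemma is_derive_ray_integral (k x : R) : (-1 < k < 1)%R ->
  is_derive (ray_integral k) x (/ sqrt (quartic k x))%R.
Proof.
  intros Hk. apply (is_derive_RInt (fun u => (/ sqrt (quartic k u))%R) _ 0%R x).
  - apply filter_forall. intro y. apply (RInt_correct (V := R_CompleteNormedModule)).
    apply (ex_RInt_continuous (V := R_CompleteNormedModule)). intros. apply continuous_inv_sqrt_quartic. exact Hk.
  - apply continuous_inv_sqrt_quartic. exact Hk.
Qed.

Lemma ray_integral_0 (k : R) : ray_integral k 0 = 0%R.
Proof. apply (RInt_point (V := R_CompleteNormedModule)). Qed.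

Lemma ray_integral_incr (k x y : R) : (-1 < k < 1)%R -> (x < y)%R ->
  (ray_integral k x < ray_integral k y)%R.
Proof.
  intros Hk Hxy.
  destruct (MVT_gen (ray_integral k) x y (fun u => (/ sqrt (quartic k u))%R)) as [c [Hc E]].
  - intros u _. apply is_derive_ray_integral. exact Hk.
  - intros u _. apply continuity_pt_filterlim.
    apply @ex_derive_continuous. eexists. apply is_derive_ray_integral. exact Hk.
  - pose proof (sqrt_lt_R0 _ (quartic_pos k c Hk)) as S. apply Rinv_0_lt_compat in S. nra.
Qed.

Lemma direction_ray_disk (d : C) (sg x : R) : is_direction d sg -> (-1 < x < 1)%R ->
  unit_disk (d * RtoC x).
Proof.
  intros Hd Hx. unfold unit_disk. rewrite Cmod_mult, (direction_mod _ _ Hd), Cmod_R, Rmult_1_l.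
  apply Rabs_def1; lra.
Qed.

Lemma polynomial_on_direction (d : C) (sg k x : R) : is_direction d sg ->
  (d * RtoC x) ^ 4 - RtoC (2 * k) * (d * RtoC x) ^ 2 + 1 = RtoC (quartic (sg * k) x).
Proof.
  intros Hd. pose proof (RtoC_sg _ _ Hd) as S. destruct Hd as [Hd _ _].
  replace ((d * RtoC x) ^ 4) with ((d * d) * (d * d) * RtoC x ^ 4) by ring.
  replace ((d * RtoC x) ^ 2) with ((d * d) * RtoC x ^ 2) by ring.
  rewrite Hd, S. unfold quartic.
  rewrite <- !RtoC_pow, <- !RtoC_mult, <- RtoC_minus, <- RtoC_plus.
  f_equal. ring.
Qed.

Lemma branch_on_direction (t : R) (s : C -> C) (d : C) (sg x : R) :
  is_sqrt_branch t s -> is_direction d sg -> (-1 < sg * cos (2 * t) < 1)%R -> (-1 < x < 1)%R ->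
  s (d * RtoC x) = RtoC (sqrt (quartic (sg * cos (2 * t)) x)).
Proof.
  intros Hs Hd Hk Hx.
  pose proof (direction_ray_disk d sg x Hd Hx) as U.
  pose proof (sqrt_branch_unique (fun y => s (RtoC y * (d * RtoC x)))
     (fun y => RtoC (sqrt (quartic (sg * cos (2 * t)) (y * x))))) as H.
  cbv beta in H. rewrite Cmult_1_l, Rmult_1_l in H. apply H.
  - intros y Hy. pose proof (unit_disk_ray (d * RtoC x) y U Hy) as Uy.
    pose proof (quartic_pos _ (y * x) Hk) as P. split.
    + rewrite (branch_sq t s Hs) by exact Uy.
      rewrite <- RtoC_pow, pow2_sqrt by lra.
      rewrite <- (polynomial_on_direction d sg) by exact Hd.
      replace (RtoC y * (d * RtoC x)) with (d * RtoC (y * x)) by (rewrite RtoC_mult; ring).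
      reflexivity.
    + intro E. apply RtoC_inj in E. pose proof (sqrt_lt_R0 _ P). lra.
  - intros y Hy. split.
    + apply (branch_continuous_ray t s Hs). apply unit_disk_ray; assumption.
    + apply continuous_RtoC.
      apply (continuous_comp (fun y => (y * x)%R) (fun v => sqrt (quartic (sg * cos (2 * t)) v))).
      * apply (continuous_mult (K := R_AbsRing)); [apply continuous_id | apply continuous_const].
      * apply @ex_derive_continuous.
        eexists. apply is_derive_sqrt_quartic. exact Hk.
  - rewrite Cmult_0_l, (proj2 (proj2 Hs)). unfold quartic.
    replace ((0 * x) ^ 4 - 2 * (sg * cos (2 * t)) * (0 * x) ^ 2 + 1)%R with 1%R by ring.
    rewrite sqrt_1. reflexivity.
Qed.

Lemma is_RInt_C (f : R -> C) (a b : R) (l : C) :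
  is_RInt (V := R_NormedModule) (fun x => Re (f x)) a b (Re l) ->
  is_RInt (V := R_NormedModule) (fun x => Im (f x)) a b (Im l) ->
  is_RInt (V := C_R_CompleteNormedModule) f a b l.
Proof.
  intros H1 H2. destruct l as [l1 l2].
  apply (is_RInt_fct_extend_pair f a b l1 l2); assumption.
Qed.

Lemma elliptic_on_direction (t : R) (E : C -> C) (d : C) (sg x : R) :
  is_elliptic_integral t E -> is_direction d sg -> (-1 < sg * cos (2 * t) < 1)%R -> (-1 < x < 1)%R ->
  E (d * RtoC x) = d * RtoC (ray_integral (sg * cos (2 * t)) x).
Proof.
  intros [s [Hs [HE _]]] Hd Hk Hx. set (k := (sg * cos (2 * t))%R) in *.
  rewrite HE by (apply (direction_ray_disk d sg); assumption).
  unfold segment_integral.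
  assert (I : is_RInt (V := R_NormedModule) (fun y => (x * / sqrt (quartic k (x * y + 0)))%R) 0 1 (ray_integral k x)).
  { apply (is_RInt_comp_lin (V := R_NormedModule) (fun u => (/ sqrt (quartic k u))%R) x 0 0 1).
    rewrite Rmult_0_r, Rplus_0_l, Rmult_1_r, Rplus_0_r.
    apply (RInt_correct (V := R_CompleteNormedModule)).
    apply (ex_RInt_continuous (V := R_CompleteNormedModule)).
    intros. apply continuous_inv_sqrt_quartic. exact Hk. }
  apply (is_RInt_unique (V := C_R_CompleteNormedModule)).
  apply (is_RInt_ext (V := C_R_CompleteNormedModule)
     (fun y : R => d * RtoC (x * / sqrt (quartic k (x * y + 0))))).
  - intros y Hy. rewrite Rmin_left, Rmax_right in Hy by lra.
    replace (RtoC y * (d * RtoC x)) with (d * RtoC (x * y))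
      by (rewrite RtoC_mult; ring).
    rewrite (branch_on_direction t s d sg (x * y) Hs Hd Hk) by nra. fold k.
    pose proof (sqrt_lt_R0 _ (quartic_pos k (x * y) Hk)) as S.
    rewrite Rplus_0_r, RtoC_mult, RtoC_inv by lra.
    match goal with |- @eq _ ?u ?v => change (@eq C u v) end. ring.
  - apply is_RInt_C.
    + replace (Re (d * RtoC (ray_integral k x))) with (Re d * ray_integral k x)%R
        by (destruct d; simpl; ring).
      apply (is_RInt_ext (V := R_NormedModule) (fun y => (Re d * (x * / sqrt (quartic k (x * y + 0))))%R)).
      * intros y _. destruct d; simpl.
        match goal with |- @eq _ ?u ?v => change (@eq R u v) end. ring.
      * apply (is_RInt_scal (V := R_NormedModule)). exact I.
    + replace (Im (d * RtoC (ray_integral k x))) with (Im d * ray_integral k x)%R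
        by (destruct d; simpl; ring).
      apply (is_RInt_ext (V := R_NormedModule) (fun y => (Im d * (x * / sqrt (quartic k (x * y + 0))))%R)).
      * intros y _. destruct d; simpl.
        match goal with |- @eq _ ?u ?v => change (@eq R u v) end. ring.
      * apply (is_RInt_scal (V := R_NormedModule)). exact I.
Qed.

Lemma elliptic_reflect (t : R) (E : C -> C) (d : C) (sg : R) (z : C) :
  is_elliptic_integral t E -> is_direction d sg -> unit_disk z ->
  E (RtoC sg * Cconj z) = RtoC sg * Cconj (E z).
Proof.
  intros [s [Hs [HE _]]] Hd Hz.
  assert (Hz' : unit_disk (RtoC sg * Cconj z)).
  { unfold unit_disk in *. rewrite <- (Cmod_conj z) in Hz. rewrite Cmod_mult.
    replace (RtoC sg) with (d * d) by apply Hd.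
    rewrite Cmod_mult, (direction_mod _ _ Hd). lra. }
  rewrite !HE by assumption. unfold segment_integral.
  set (h := fun x : R => z * / s (RtoC x * z)).
  assert (X : ex_RInt (V := C_R_CompleteNormedModule) h 0%R 1%R).
  { apply (ex_RInt_continuous (V := C_R_CompleteNormedModule)).
    intros y Hy. rewrite Rmin_left, Rmax_right in Hy by lra.
    pose proof (unit_disk_ray z y Hz Hy) as Uy.
    apply continuous_Cmult; [apply continuous_const|]. apply continuous_Cinv.
    - apply (branch_continuous_ray t s Hs). exact Uy.
    - apply (branch_neq_0 t s Hs). exact Uy. }
  apply (RInt_correct (V := C_R_CompleteNormedModule)) in X.
  set (I := RInt (V := C_R_CompleteNormedModule) h 0%R 1%R) in *.
  apply (is_RInt_unique (V := C_R_CompleteNormedModule)).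
  apply (is_RInt_ext (V := C_R_CompleteNormedModule) (fun y : R => RtoC sg * Cconj (h y))).
  - intros y Hy. rewrite Rmin_left, Rmax_right in Hy by lra.
    pose proof (unit_disk_ray z y Hz ltac:(lra)) as Uy. unfold h.
    rewrite Cmult_conj, Cinv_conj by (apply (branch_neq_0 t s Hs); exact Uy).
    rewrite <- (branch_reflect t s Hs d sg) by assumption.
    rewrite Cmult_conj, Cconj_R.
    replace (RtoC sg * (RtoC y * Cconj z)) with (RtoC y * (RtoC sg * Cconj z)) by ring.
    match goal with |- @eq _ ?u ?v => change (@eq C u v) end. ring.
  - apply is_RInt_C.
    + replace (Re (RtoC sg * Cconj I)) with (sg * Re I)%R by (destruct I; simpl; ring).
      apply (is_RInt_ext (V := R_NormedModule) (fun y => (sg * Re (h y))%R)).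
      * intros y _. destruct (h y); simpl.
        match goal with |- @eq _ ?u ?v => change (@eq R u v) end. ring.
      * apply (is_RInt_scal (V := R_NormedModule)).
        apply (is_RInt_fct_extend_fst (U := R_NormedModule) (V := R_NormedModule) h 0%R 1%R I X).
    + replace (Im (RtoC sg * Cconj I)) with (- sg * Im I)%R by (destruct I; simpl; ring).
      apply (is_RInt_ext (V := R_NormedModule) (fun y => (- sg * Im (h y))%R)).
      * intros y _. destruct (h y); simpl.
        match goal with |- @eq _ ?u ?v => change (@eq R u v) end. ring.
      * apply (is_RInt_scal (V := R_NormedModule)).
        apply (is_RInt_fct_extend_snd (U := R_NormedModule) (V := R_NormedModule) h 0%R 1%R I X).
Qed.

(** The elliptic integral maps the diameter in the direction [d] onto the full segment
    in which the line through [d] cuts the image. If the increasing function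
    [ray_integral] stopped short at [L < W], the point [d L] would be attained somewhere in
    the disk; by reflection and injectivity it would be attained on the diameter. *)
Lemma ray_integral_limit (t : R) (E : C -> C) (d : C) (sg W : R) :
  is_elliptic_integral t E -> is_direction d sg -> (-1 < sg * cos (2 * t) < 1)%R ->
  (forall z w, unit_disk z -> unit_disk w -> E z = E w -> z = w) ->
  (forall y : R, (- W < y < W)%R <-> exists z, unit_disk z /\ d * RtoC y = E z) ->
  filterlim (ray_integral (sg * cos (2 * t))) (at_left 1) (locally W) /\
  E d = d * RtoC W.
Proof.
  intros HE Hd Hk Hinj Hon. set (k := (sg * cos (2 * t))%R) in *.
  pose proof (direction_neq_0 _ _ Hd) as d0.
  assert (Inside : at_left 1 (fun x => (0 < x < 1)%R)).
  { exists (mkposreal 1 Rlt_0_1). intros y Hy Hy1. split; [|exact Hy1].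
    apply Rabs_def2 in Hy. unfold minus, plus, opp in Hy. simpl in Hy. lra. }
  assert (LE : filterlim (fun x : R => E (d * RtoC x)) (at_left 1) (locally (E d))).
  { destruct HE as [s [_ [_ Hlim]]].
    eapply filterlim_comp; [|apply Hlim; apply (direction_mod _ _ Hd)].
    intros P HP. unfold within in HP.
    assert (C1 : continuous (T := R_UniformSpace) (U := C_UniformSpace) (fun x : R => d * RtoC x) 1%R).
    { apply continuous_Cmult; [apply continuous_const | apply continuous_RtoC, continuous_id]. }
    unfold continuous in C1. rewrite Cmult_1_r in C1. specialize (C1 _ HP).
    unfold filtermap in *.
    assert (C1' : at_left 1 (fun x : R => unit_disk (d * RtoC x) -> P (d * RtoC x))).
    { unfold at_left, within. revert C1. apply filter_imp. intros x Hx _. exact Hx. }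
    generalize (filter_and _ _ C1' Inside). apply filter_imp.
    intros x [H1 H2]. apply H1. apply (direction_ray_disk d sg); [exact Hd | lra]. }
  assert (Val : forall x, (-1 < x < 1)%R -> E (d * RtoC x) = d * RtoC (ray_integral k x)).
  { intros x Hx. apply (elliptic_on_direction t E d sg x HE Hd Hk Hx). }
  assert (cd : Cconj d * d = 1).
  { rewrite (dir_conj _ _ Hd), <- Cmult_assoc, (dir_sq _ _ Hd). apply (RtoC_sg _ _ Hd). }
  set (L := Re (Cconj d * E d)).
  assert (LF : filterlim (ray_integral k) (at_left 1) (locally L)).
  { apply (filterlim_ext_loc (fun x : R => Re (Cconj d * E (d * RtoC x)))).
    - revert Inside. apply filter_imp. intros x Hx. rewrite Val by lra.
      rewrite Cmult_assoc, cd, Cmult_1_l. reflexivity.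
    - apply (filterlim_comp _ _ _ (fun x : R => E (d * RtoC x)) (fun w => Re (Cconj d * w))
               _ (locally (E d))); [exact LE|].
      apply (continuous_Re (U := C_UniformSpace) (fun w => Cconj d * w)).
      apply continuous_Cmult; [apply continuous_const | apply continuous_id]. }
  assert (Ed : E d = d * RtoC L).
  { apply (filterlim_locally_unique (V := C_R_NormedModule) (F := at_left 1)
             (fun x : R => E (d * RtoC x))); [exact LE|].
    apply (filterlim_ext_loc (fun x : R => d * RtoC (ray_integral k x))).
    - revert Inside. apply filter_imp. intros x Hx. symmetry. apply Val. lra.
    - apply (filterlim_comp _ _ _ (ray_integral k) (fun y : R => d * RtoC y) _ (locally L)); [exact LF|].
      apply (continuous_Cmult (U := R_UniformSpace)); [apply continuous_const | apply continuous_RtoC, continuous_id]. }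
  assert (Fle : forall x, (-1 < x < 1)%R -> (ray_integral k x <= L)%R).
  { intros x Hx.
    apply (filterlim_le (F := at_left 1) (fun _ => ray_integral k x) (ray_integral k)
             (ray_integral k x) L); [| apply filterlim_const | exact LF].
    assert (P0 : (0 < 1 - x)%R) by lra.
    exists (mkposreal _ P0). intros y Hy Hy1.
    apply Rabs_def2 in Hy. unfold minus, plus, opp in Hy. simpl in Hy.
    left. apply ray_integral_incr; [exact Hk | lra]. }
  assert (Flt : forall x, (-1 < x < 1)%R -> (- W < ray_integral k x < W)%R).
  { intros x Hx. apply Hon. exists (d * RtoC x). split; [apply (direction_ray_disk d sg); assumption|].
    symmetry. apply Val. exact Hx. }
  assert (LW : (L <= W)%R).
  { apply (filterlim_le (F := at_left 1) (ray_integral k) (fun _ => W) L W); [| exact LF | apply filterlim_const].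
    revert Inside. apply filter_imp. intros x Hx. left. apply Flt. lra. }
  destruct (Rle_lt_or_eq_dec _ _ LW) as [Lt|Eq]; [exfalso | rewrite <- Eq; split; assumption].
  (* [d L] is a value of [E], at a point [z] which the reflection fixes. *)
  pose proof (Fle 0%R ltac:(lra)) as L0. rewrite ray_integral_0 in L0.
  destruct (proj1 (Hon L)) as [z [Hz Ez]]; [lra|].
  assert (Zr : RtoC sg * Cconj z = z).
  { apply Hinj; [| exact Hz |].
    - unfold unit_disk in *. rewrite <- (Cmod_conj z) in Hz. rewrite Cmod_mult.
      replace (RtoC sg) with (d * d) by apply Hd.
      rewrite Cmod_mult, (direction_mod _ _ Hd). lra.
    - rewrite (elliptic_reflect t E d sg z HE Hd Hz), <- Ez, Cmult_conj, Cconj_R, (dir_conj _ _ Hd).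
      rewrite !Cmult_assoc, (RtoC_sg _ _ Hd). ring. }
  set (y := Cconj d * z).
  assert (zy : z = d * y) by (unfold y; rewrite Cmult_assoc, (Cmult_comm d), cd; ring).
  assert (yr : Cconj y = y).
  { unfold y at 1. rewrite Cmult_conj, Cconj_conj. unfold y. rewrite (dir_conj _ _ Hd).
    rewrite <- Zr at 2. rewrite !Cmult_assoc.
    replace (RtoC sg * d * RtoC sg) with (RtoC sg * RtoC sg * d) by ring.
    rewrite (RtoC_sg _ _ Hd). ring. }
  assert (yR : y = RtoC (Re y)).
  { destruct y as [y1 y2]. unfold Cconj in yr. simpl in yr. injection yr. intro Q.
    unfold RtoC. simpl. f_equal. lra. }
  rewrite yR in zy. set (r := Re y) in *.
  assert (Hr : (-1 < r < 1)%R).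
  { unfold unit_disk in Hz. rewrite zy, Cmod_mult, (direction_mod _ _ Hd), Cmod_R, Rmult_1_l in Hz.
    apply Rabs_def2 in Hz. lra. }
  rewrite zy, Val in Ez by exact Hr.
  assert (Q : RtoC L = RtoC (ray_integral k r)).
  { rewrite <- (Cmult_1_l (RtoC L)), <- cd, <- Cmult_assoc, Ez, Cmult_assoc, cd. ring. }
  apply RtoC_inj in Q.
  pose proof (ray_integral_incr k r ((1 + r) / 2) Hk ltac:(lra)).
  pose proof (Fle ((1 + r) / 2)%R ltac:(lra)). lra.
Qed.

(** * The Schwarzian of g at the centre and at the midpoints of the sides *)

(** The quartic times the Schwarzian of [g], transported to the line through [d]; it is a
    polynomial, hence keeps a meaning at [x = 1]. *)
Definition side_poly (t lambda : R) (d : C) (sg x : R) : C :=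
  RtoC (4 * sin t ^ 2) *
    ((d * RtoC x) ^ 4 - RtoC (16 * cos t) * (d * RtoC x) ^ 3
     + RtoC (4 + 2 * cos (2 * t)) * (d * RtoC x) ^ 2
     - RtoC (16 * cos t) * (d * RtoC x) + 1)
  + RtoC (64 * lambda * cos t * quartic (sg * cos (2 * t)) x
          + 4 * sg * ((6 * x ^ 2 - 2 * (sg * cos (2 * t))) * quartic (sg * cos (2 * t)) x
                      - 6 * (x ^ 3 - sg * cos (2 * t) * x) ^ 2)).

(** [schwarzian_along_segment] made explicit; the factor [quartic] clears the denominators. *)
Lemma phi_on_direction (t lambda mu w1 : R) (w2 : C) (f g E : C -> C) (d : C) (sg x : R) :
  is_elliptic_integral t E -> is_direction d sg -> (-1 < sg * cos (2 * t) < 1)%R ->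
  is_schwarzian_on unit_disk f (Rtl t lambda) ->
  is_schwarzian_on (rectangle w1 w2) g (phi w1 w2 mu) ->
  (forall z, unit_disk z -> rectangle w1 w2 (E z / 2) /\ f z = g (E z / 2)) ->
  (-1 < x < 1)%R ->
  RtoC (quartic (sg * cos (2 * t)) x)
    * phi w1 w2 mu (d * RtoC (ray_integral (sg * cos (2 * t)) x) / 2)
  = side_poly t lambda d sg x.
Proof.
  intros HE Hd Hk Hf Hg Hfg Hx.
  set (k := (sg * cos (2 * t))%R) in *.
  pose proof (quartic_pos k x Hk) as P.
  assert (P0 : RtoC (quartic k x) <> 0) by (intro Z; apply RtoC_inj in Z; lra).
  rewrite (schwarzian_along_segment unit_disk (rectangle w1 w2) f g (Rtl t lambda) (phi w1 w2 mu) d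
    (ray_integral k) (fun y => sqrt (quartic k y))
    (fun y => (2 * y ^ 3 - 2 * k * y) / quartic k y)%R
    (fun y => (6 * y ^ 2 - 2 * k) / quartic k y - 2 * ((2 * y ^ 3 - 2 * k * y) / quartic k y) ^ 2)%R
    Hf Hg (direction_neq_0 _ _ Hd)) with (x := x).
  - rewrite <- RtoC_pow, pow2_sqrt by lra.
    unfold Rtl, psi0, psi1. rewrite (polynomial_on_direction d sg) by exact Hd. fold k.
    replace (d ^ 2) with (RtoC sg) by (rewrite <- (dir_sq _ _ Hd); ring).
    assert (sg0 : RtoC sg <> 0).
    { intro Z. pose proof (RtoC_sg _ _ Hd) as S. rewrite Z in S.
      rewrite Cmult_0_l in S. apply RtoC_inj in S. lra. }
    set (N0 := (d * RtoC x) ^ 4 - _ + _ - _ + 1).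
    unfold side_poly. fold k. fold N0.
    replace (((6 * x ^ 2 - 2 * k) / quartic k x - 2 * ((2 * x ^ 3 - 2 * k * x) / quartic k x) ^ 2) +
        ((2 * x ^ 3 - 2 * k * x) / quartic k x) ^ 2 / 2)%R
      with (((6 * x ^ 2 - 2 * k) * quartic k x - 6 * (x ^ 3 - k * x) ^ 2) / quartic k x ^ 2)%R
      by (field; lra).
    set (B := ((6 * x ^ 2 - 2 * k) * quartic k x - 6 * (x ^ 3 - k * x) ^ 2)%R).
    set (q := quartic k x) in *.
    rewrite RtoC_div by (apply pow_nonzero; lra).
    rewrite (RtoC_pow q 2), (RtoC_plus _ (4 * sg * B)), (RtoC_mult _ B), (RtoC_mult 4 sg), (RtoC_mult 4 (sin t ^ 2)).
    replace (RtoC (64 * lambda * cos t * q)) with (- 8 * RtoC lambda * RtoC (- 8 * cos t) * RtoC q)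
      by (rewrite <- !RtoC_mult; f_equal; ring).
    set (l := RtoC lambda). set (c8 := RtoC (- 8 * cos t)). set (s2 := RtoC (sin t ^ 2)).
    set (rq := RtoC q) in *. set (rB := RtoC B).
    replace (RtoC 4 * RtoC sg * rB) with (4 * rB / RtoC sg).
    { clearbody l c8 s2 rq rB N0. field. split; assumption. }
    pose proof (RtoC_sg _ _ Hd) as S. set (rs := RtoC sg) in *.
    replace (4 * rs * rB) with (4 * rB * (rs * rs) / rs) by (field; exact sg0).
    rewrite S. field. exact sg0.
  - intros y Hy. pose proof (direction_ray_disk d sg y Hd Hy) as U.
    pose proof (elliptic_on_direction t E d sg y HE Hd Hk Hy) as V. fold k in V.
    split; [exact U|]. rewrite <- V. apply Hfg. exact U.
  - intros y Hy. split; [apply sqrt_lt_R0, quartic_pos, Hk|].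
    split; [apply is_derive_ray_integral, Hk|].
    split; [apply is_derive_sqrt_quartic, Hk | apply is_derive_log_sqrt_quartic, Hk].
  - exact Hx.
Qed.

Lemma continuous_side_poly (t lambda : R) (d : C) (sg x : R) :
  continuous (T := R_UniformSpace) (U := C_UniformSpace) (side_poly t lambda d sg) x.
Proof.
  assert (Z : continuous (T := R_UniformSpace) (U := C_UniformSpace) (fun y : R => d * RtoC y) x).
  { apply (continuous_Cmult (U := R_UniformSpace)); [apply continuous_const | apply continuous_RtoC, continuous_id]. }
  unfold side_poly. apply continuous_Cplus.
  - apply continuous_Cmult; [apply continuous_const|].
    unfold Cminus.
    apply continuous_Cplus; [|apply continuous_const].
    apply continuous_Cplus;
      [|apply continuous_Copp, continuous_Cmult; [apply continuous_const | exact Z]].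
    apply continuous_Cplus;
      [|apply continuous_Cmult; [apply continuous_const | apply continuous_Cpow; exact Z]].
    apply continuous_Cplus; [apply continuous_Cpow; exact Z|].
    apply continuous_Copp, continuous_Cmult; [apply continuous_const | apply continuous_Cpow; exact Z].
  - apply continuous_RtoC. apply @ex_derive_continuous. unfold quartic. auto_derive. exact I.
Qed.

Lemma continuous_phi (w1 b mu : R) (z : C) :
  (0 < w1)%R -> (0 < b)%R ->
  (forall m n, z + (RtoC w1 + (0%R, b)) / 2 <> lattice_point w1 (0%R, b) m n) ->
  (forall m n, z + (RtoC w1 - (0%R, b)) / 2 <> lattice_point w1 (0%R, b) m n) ->
  continuous (T := C_UniformSpace) (U := C_UniformSpace) (phi w1 (0%R, b) mu) z.
Proof.
  intros H1 Hb N1 N2. unfold phi.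
  apply continuous_Cplus; [|apply continuous_const].
  apply continuous_Cmult; [apply continuous_const|].
  apply continuous_Cplus.
  - apply (continuous_comp (fun u => u + (RtoC w1 + (0%R, b)) / 2) (wp w1 (0%R, b))).
    + apply continuous_Cplus; [apply continuous_id | apply continuous_const].
    + apply continuous_wp; assumption.
  - apply (continuous_comp (fun u => u + (RtoC w1 - (0%R, b)) / 2) (wp w1 (0%R, b))).
    + apply continuous_Cplus; [apply continuous_id | apply continuous_const].
    + apply continuous_wp; assumption.
Qed.

(** The identity of [phi_on_direction] persists at [x = 1], where [d W / 2] is the midpoint
    of a side of the rectangle. *)
Lemma phi_at_side_midpoint (t lambda mu w1 b W : R) (d : C) (sg : R) :
  (forall x, (-1 < x < 1)%R ->
    RtoC (quartic (sg * cos (2 * t)) x)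
      * phi w1 (0%R, b) mu (d * RtoC (ray_integral (sg * cos (2 * t)) x) / 2)
    = side_poly t lambda d sg x) ->
  filterlim (ray_integral (sg * cos (2 * t))) (at_left 1) (locally W) ->
  continuous (T := C_UniformSpace) (U := C_UniformSpace) (phi w1 (0%R, b) mu) (d * RtoC W / 2) ->
  RtoC (quartic (sg * cos (2 * t)) 1) * phi w1 (0%R, b) mu (d * RtoC W / 2)
  = side_poly t lambda d sg 1.
Proof.
  intros H HF HC. set (k := (sg * cos (2 * t))%R) in *.
  assert (Inside : at_left 1 (fun x => (0 < x < 1)%R)).
  { exists (mkposreal 1 Rlt_0_1). intros y Hy Hy1. split; [|exact Hy1].
    apply Rabs_def2 in Hy. unfold minus, plus, opp in Hy. simpl in Hy. lra. }
  apply (filterlim_locally_unique (V := C_R_NormedModule) (F := at_left 1)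
     (fun x : R => side_poly t lambda d sg x)).
  - apply (filterlim_ext_loc (fun x : R => RtoC (quartic k x)
       * phi w1 (0%R, b) mu (d * RtoC (ray_integral k x) / 2))).
    { revert Inside. apply filter_imp. intros x Hx. apply H. lra. }
    assert (HC2 : continuous (T := prod_UniformSpace R_UniformSpace R_UniformSpace)
        (U := C_UniformSpace)
        (fun p : R * R => RtoC (quartic k (fst p)) * phi w1 (0%R, b) mu (d * RtoC (snd p) / 2)) (1%R, W)).
    { apply continuous_Cmult.
      - apply continuous_RtoC. apply (continuous_comp fst (quartic k)); [apply continuous_fst|].
        apply @ex_derive_continuous. eexists. apply is_derive_quartic.
      - apply (continuous_comp (fun p : R * R => d * RtoC (snd p) / 2) (phi w1 (0%R, b) mu));
          [|exact HC].
        apply continuous_Cmult; [|apply continuous_const].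
        apply continuous_Cmult; [apply continuous_const|].
        apply continuous_RtoC, continuous_snd. }
    intros P HP. destruct (HC2 P HP) as [eps Heps].
    assert (B1 : at_left 1 (fun x => ball 1%R eps x)).
    { exists eps. intros y Hy _. exact Hy. }
    assert (B2 : at_left 1 (fun x => ball W eps (ray_integral k x)))
      by (apply HF; apply locally_ball).
    unfold filtermap. generalize (filter_and _ _ B1 B2). apply filter_imp. intros x [X1 X2].
    apply (Heps (x, ray_integral k x)). split; assumption.
  - intros P HP. specialize (continuous_side_poly t lambda d sg 1 P HP).
    unfold filtermap, at_left, within. apply filter_imp. intros y Hy _. exact Hy.
Qed.

(** The centre of the rectangle, counted twice, and the four midpoints of the sides bring
    in exactly the twelve points of order 4. *)
Lemma phi_midpoint_sum (w1 b mu : R) : (0 < w1)%R -> (0 < b)%R ->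
  let ph d W := phi w1 (0%R, b) mu (d * RtoC W / 2) in
  2 * phi w1 (0%R, b) mu 0 + ph 1 w1 + ph (- 1) w1 + ph Ci b + ph (- Ci) b = 24 * RtoC mu.
Proof.
  intros H1 Hb ph.
  pose proof (wp_four_torsion_sum (w1 / 2) (b / 2) ltac:(lra) ltac:(lra)) as T.
  cbv beta zeta in T.
  replace (2 * (w1 / 2))%R with w1 in T by field.
  replace (2 * (b / 2))%R with b in T by field.
  unfold ph, phi.
  set (c := (0%R, (b / 2)%R) : C) in *. set (a := RtoC (w1 / 2)) in *.
  assert (Ea : RtoC w1 = 2 * a) by (unfold a; rewrite <- RtoC_mult; f_equal; field).
  assert (Ec : ((0%R, b) : C) = 2 * c).
  { unfold c, RtoC, Cmult. simpl. f_equal; field. }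
  assert (Eib : Ci * RtoC b = 2 * c).
  { rewrite <- Ec. unfold Ci, RtoC, Cmult. simpl. f_equal; ring. }
  set (p := wp (RtoC w1) (0%R, b)) in *. clearbody p.
  assert (Nib : - Ci * RtoC b = - (2 * c)) by (rewrite <- Eib; ring).
  rewrite Eib, Nib, Ec, Ea. clearbody a c.
  replace (0 + (2 * a + 2 * c) / 2) with (1 * a + 1 * c) by field.
  replace (0 + (2 * a - 2 * c) / 2) with (1 * a + -1 * c) by field.
  replace (1 * (2 * a) / 2 + (2 * a + 2 * c) / 2) with (2 * a + 1 * c) by field.
  replace (1 * (2 * a) / 2 + (2 * a - 2 * c) / 2) with (2 * a + -1 * c) by field.
  replace (-1 * (2 * a) / 2 + (2 * a + 2 * c) / 2) with (0 * a + 1 * c) by field.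
  replace (-1 * (2 * a) / 2 + (2 * a - 2 * c) / 2) with (0 * a + -1 * c) by field.
  replace (2 * c / 2 + (2 * a + 2 * c) / 2) with (1 * a + 2 * c) by field.
  replace (2 * c / 2 + (2 * a - 2 * c) / 2) with (1 * a + 0 * c) by field.
  replace (- (2 * c) / 2 + (2 * a + 2 * c) / 2) with (1 * a + 0 * c) by field.
  replace (- (2 * c) / 2 + (2 * a - 2 * c) / 2) with (1 * a + -2 * c) by field.
  match goal with |- ?l = _ =>
    match type of T with ?u = _ => replace l with (24 * RtoC mu - 4 * u) by ring end end.
  rewrite T. ring.
Qed.

Lemma lattice_point_neq (w1 b : R) (k l : Z) :
  (0 < w1)%R -> (0 < b)%R -> (k mod 4 <> 0 \/ l mod 4 <> 0)%Z ->
  forall m n, RtoC (IZR k) * RtoC (w1 / 2) + RtoC (IZR l) * (0%R, (b / 2)%R) <> lattice_point w1 (0%R, b) m n.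
Proof.
  intros H1 Hb Hkl m n E. unfold lattice_point in E.
  assert (E1 : (IZR k * (w1 / 2) = 2 * IZR m * w1)%R) by (apply (f_equal Re) in E; simpl in E; lra).
  assert (E2 : (IZR l * (b / 2) = 2 * IZR n * b)%R) by (apply (f_equal Im) in E; simpl in E; lra).
  assert (K : k = (m * 4)%Z).
  { apply eq_IZR. rewrite mult_IZR. apply Rmult_eq_reg_r with (w1 / 2)%R; [|lra]. rewrite E1. field. }
  assert (L : l = (n * 4)%Z).
  { apply eq_IZR. rewrite mult_IZR. apply Rmult_eq_reg_r with (b / 2)%R; [|lra]. rewrite E2. field. }
  subst k l. rewrite !Z_mod_mult in Hkl. lia.
Qed.

(** The arithmetic condition keeps the two arguments of [wp] in [phi] off the lattice. *)
Lemma continuous_phi_point (w1 b mu : R) (k l : Z) (z : C) :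
  (0 < w1)%R -> (0 < b)%R -> ((k + 1) mod 4 <> 0)%Z \/ ((l + 1) mod 4 <> 0 /\ (l - 1) mod 4 <> 0)%Z ->
  z = RtoC (IZR k) * RtoC (w1 / 2) + RtoC (IZR l) * (0%R, (b / 2)%R) ->
  continuous (T := C_UniformSpace) (U := C_UniformSpace) (phi w1 (0%R, b) mu) z.
Proof.
  intros H1 Hb Hkl ->.
  assert (Ea : RtoC w1 = 2 * RtoC (w1 / 2)) by (rewrite <- RtoC_mult; f_equal; field).
  assert (Ec : ((0%R, b) : C) = 2 * (0%R, (b / 2)%R)).
  { unfold RtoC, Cmult. simpl. f_equal; field. }
  apply continuous_phi; try assumption; intros m n.
  - replace (_ + (RtoC w1 + (0%R, b)) / 2)
      with (RtoC (IZR (k + 1)) * RtoC (w1 / 2) + RtoC (IZR (l + 1)) * (0%R, (b / 2)%R)).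
    + apply lattice_point_neq; tauto.
    + rewrite Ea, Ec, !plus_IZR, !RtoC_plus. field.
  - replace (_ + (RtoC w1 - (0%R, b)) / 2)
      with (RtoC (IZR (k + 1)) * RtoC (w1 / 2) + RtoC (IZR (l - 1)) * (0%R, (b / 2)%R)).
    + apply lattice_point_neq; tauto.
    + rewrite Ea, Ec, minus_IZR, plus_IZR, RtoC_minus, RtoC_plus. field.
Qed.

(** Adding opposite directions removes the odd powers of [d]. *)
Lemma side_poly_pair (t lambda : R) (d : C) (sg : R) : is_direction d sg ->
  side_poly t lambda d sg 1 + side_poly t lambda (- d) sg 1 =
  RtoC (2 * (4 * sin t ^ 2 * (2 + (4 + 2 * cos (2 * t)) * sg)
    + 64 * lambda * cos t * quartic (sg * cos (2 * t)) 1
    + 4 * sg * ((6 - 2 * (sg * cos (2 * t))) * quartic (sg * cos (2 * t)) 1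
                - 6 * (1 - sg * cos (2 * t)) ^ 2))).
Proof.
  intros Hd. pose proof (RtoC_sg _ _ Hd) as S. pose proof (dir_sq _ _ Hd) as Q.
  unfold side_poly. rewrite pow1, Rmult_1_r. rewrite (pow1 3), Rmult_1_r.
  replace ((d * RtoC 1) ^ 4) with ((d * d) * (d * d)) by ring.
  replace ((- d * RtoC 1) ^ 4) with ((d * d) * (d * d)) by ring.
  replace ((d * RtoC 1) ^ 2) with (d * d) by ring.
  replace ((- d * RtoC 1) ^ 2) with (d * d) by ring.
  rewrite Q, S.
  set (B := (64 * lambda * cos t * quartic (sg * cos (2 * t)) 1 +
    4 * sg * ((6 - 2 * (sg * cos (2 * t))) * quartic (sg * cos (2 * t)) 1
      - 6 * (1 - sg * cos (2 * t)) ^ 2))%R).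
  rewrite (Rplus_assoc _ (64 * lambda * cos t * quartic (sg * cos (2 * t)) 1)). fold B.
  rewrite (RtoC_mult 2), (RtoC_plus (4 * sin t ^ 2 * _)), (RtoC_mult (4 * sin t ^ 2)),
    (RtoC_plus 2), (RtoC_mult (4 + 2 * cos (2 * t))).
  ring.
Qed.

Theorem proposition2p3 (t lambda mu omega1 : R) (tau : C) (f g E : C -> C)
  (ht : (0 < t < PI / 2)%R)
  (htau : Cpos (tau / Ci))
  (homega1 : (0 < omega1)%R)
  (hnorm : wp omega1 (tau * omega1) omega1
           - wp omega1 (tau * omega1) (tau * omega1) = 4)
  (hE : is_elliptic_integral t E)
  (hf : conformal_on unit_disk f)
  (hg : conformal_on (rectangle omega1 (tau * omega1)) g)
  (hSf : is_schwarzian_on unit_disk f (Rtl t lambda))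
  (hSg : is_schwarzian_on (rectangle omega1 (tau * omega1)) g
           (phi omega1 (tau * omega1) mu))
  (honto : forall zeta : C,
     rectangle omega1 (tau * omega1) zeta <->
     exists z : C, unit_disk z /\ zeta = E z / 2)
  (hfg : forall z zeta : C, unit_disk z -> zeta = E z / 2 -> g zeta = f z) :
  tau / Ci = conformal_module E /\
  mu = (16 * lambda * cos t + (3 + cos (2 * t)) / 6)%R.
Proof.
  clear hnorm hg.
  destruct tau as [t1 T]. destruct htau as [hT1 hT2].
  assert (t1 = 0%R).
  { revert hT1. unfold Cdiv, Cinv, Ci. simpl. intro Q. field_simplify in Q. lra. }
  subst t1.
  assert (HT : (0 < T)%R).
  { revert hT2. unfold Cdiv, Cinv, Ci. simpl. intro Q. field_simplify in Q. lra. }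
  clear hT1 hT2.
  set (b := (T * omega1)%R).
  assert (hb : (0 < b)%R) by (apply Rmult_lt_0_compat; assumption).
  assert (Ew : (0%R, T) * RtoC omega1 = (0%R, b)).
  { unfold b, RtoC, Cmult. simpl. f_equal; ring. }
  rewrite Ew in *.
  (* [E] is injective on the disk because [f] is. *)
  assert (Hin : forall z, unit_disk z -> rectangle omega1 (0%R, b) (E z / 2) /\ f z = g (E z / 2)).
  { intros z Hz. split; [apply honto; exists z; auto | symmetry; apply hfg; auto]. }
  assert (Einj : forall z w, unit_disk z -> unit_disk w -> E z = E w -> z = w).
  { intros z w Hz Hw Q. apply (proj1 hf); try assumption.
    rewrite (proj2 (Hin z Hz)), (proj2 (Hin w Hw)), Q. reflexivity. }
  assert (C0 : (0 < cos t)%R) by (apply cos_gt_0; lra).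
  assert (S0 : (0 < sin t)%R) by (apply sin_gt_0; lra).
  assert (CS : (sin t ^ 2 = 1 - cos t ^ 2)%R) by (pose proof (sin2_cos2 t) as Q; unfold Rsqr in Q; lra).
  set (c := cos t) in *.
  assert (c2 : cos (2 * t) = (2 * c ^ 2 - 1)%R) by (rewrite cos_2a_cos; unfold c; ring).
  assert (Hc : (0 < c ^ 2 < 1)%R) by (split; [nra | nra]).
  assert (Hk1 : (-1 < 1 * cos (2 * t) < 1)%R) by (rewrite c2; lra).
  assert (Hk2 : (-1 < -1 * cos (2 * t) < 1)%R) by (rewrite c2; lra).
  assert (D1 : is_direction 1 1) by (split; [ring | ring | unfold Cconj, RtoC, Cmult; simpl; f_equal; ring]).
  assert (D2 : is_direction (-1) 1) by (split; [ring | ring | unfold Cconj, RtoC, Cmult; simpl; f_equal; ring]).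
  assert (D3 : is_direction Ci (-1)).
  { split; [unfold Ci, RtoC, Cmult; simpl; f_equal; ring | ring | unfold Cconj, Ci, RtoC, Cmult; simpl; f_equal; ring]. }
  assert (D4 : is_direction (- Ci) (-1)).
  { split; [unfold Ci, RtoC, Cmult, Copp; simpl; f_equal; ring | ring | unfold Cconj, Ci, RtoC, Cmult, Copp; simpl; f_equal; ring]. }
  assert (On : forall d W, (forall y : R, (- W < y < W)%R <-> rectangle omega1 (0%R, b) (d * RtoC y / 2)) ->
     forall y : R, (- W < y < W)%R <-> exists z, unit_disk z /\ d * RtoC y = E z).
  { intros d W H y. rewrite H, honto. split; intros [z [Hz Q]]; exists z; (split; [exact Hz|]).
    - replace (d * RtoC y) with (2 * (d * RtoC y / 2)) by field. rewrite Q. field.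
    - rewrite Q. reflexivity. }
  assert (half : forall z : C, z / 2 = ((Re z / 2)%R, (Im z / 2)%R)).
  { intros [z1 z2]. unfold Cdiv, Cinv, RtoC, Cmult. simpl. f_equal; field. }
  destruct (ray_integral_limit t E 1 1 omega1 hE D1 Hk1 Einj) as [L1 V1].
  { apply On. intro y. rewrite half. unfold rectangle. simpl. split; intros; lra. }
  destruct (ray_integral_limit t E Ci (-1) b hE D3 Hk2 Einj) as [L2 V3].
  { apply On. intro y. rewrite half. unfold rectangle. simpl. split; intros; lra. }
  split.
  { unfold conformal_module. rewrite V1, V3.
    replace (Im (Ci * RtoC b)) with b by (simpl; ring).
    unfold b. rewrite RtoC_mult. 
    replace ((0%R, T) : C) with (Ci * RtoC T) by (unfold Ci, RtoC, Cmult; simpl; f_equal; ring).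
    field. split; intro Q; [apply RtoC_inj in Q; lra | injection Q; lra]. }
  (* The Schwarzian of [g] at the midpoint of the side in the direction [d]. *)
  assert (M : forall d sg W, is_direction d sg -> (-1 < sg * cos (2 * t) < 1)%R ->
    filterlim (ray_integral (sg * cos (2 * t))) (at_left 1) (locally W) ->
    continuous (T := C_UniformSpace) (U := C_UniformSpace) (phi omega1 (0%R, b) mu) (d * RtoC W / 2) ->
    RtoC (quartic (sg * cos (2 * t)) 1) * phi omega1 (0%R, b) mu (d * RtoC W / 2)
     = side_poly t lambda d sg 1).
  { intros d sg W Hd Hk HF HC. apply phi_at_side_midpoint; try assumption.
    intros x Hx. apply (phi_on_direction t lambda mu omega1 (0%R, b) f g E d sg x); assumption. }
  pose proof (phi_on_direction t lambda mu omega1 (0%R, b) f g E 1 1 0 hE D1 Hk1 hSf hSg Hin ltac:(lra)) as M0.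
  rewrite ray_integral_0 in M0. replace (1 * RtoC 0 / 2) with (RtoC 0) in M0 by field.
  pose proof (phi_midpoint_sum omega1 b mu homega1 hb) as S. cbv beta zeta in S.
  assert (M1 := M 1 1%R omega1 D1 Hk1 L1
    ltac:(apply (continuous_phi_point omega1 b mu 1 0); try assumption;
          [left; discriminate | rewrite RtoC_div by lra; field])).
  assert (M2 := M (-1) 1%R omega1 D2 Hk1 L1
    ltac:(apply (continuous_phi_point omega1 b mu (-1) 0); try assumption;
          [right; split; discriminate | rewrite RtoC_div by lra; field])).
  assert (Z3 : Ci * RtoC b / 2
      = RtoC (IZR 0) * RtoC (omega1 / 2) + RtoC (IZR 1) * (0%R, (b / 2)%R)).
  { rewrite half. unfold Ci, RtoC, Cmult, Cplus. simpl. f_equal; field. }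
  assert (Z4 : - Ci * RtoC b / 2
      = RtoC (IZR 0) * RtoC (omega1 / 2) + RtoC (IZR (-1)) * (0%R, (b / 2)%R)).
  { rewrite half. unfold Ci, RtoC, Cmult, Cplus, Copp. simpl. f_equal; field. }
  assert (M3 := M Ci (-1)%R b D3 Hk2 L2
    ltac:(apply (continuous_phi_point omega1 b mu 0 1); try assumption; left; discriminate)).
  assert (M4 := M (- Ci) (-1)%R b D4 Hk2 L2
    ltac:(apply (continuous_phi_point omega1 b mu 0 (-1)); try assumption; left; discriminate)).
  pose proof (side_poly_pair t lambda 1 1 D1) as P1.
  pose proof (side_poly_pair t lambda Ci (-1) D3) as P2.
  replace (- (1)) with (RtoC (-1)) in P1 by (rewrite <- RtoC_opp; reflexivity).
  rewrite <- M1, <- M2 in P1. rewrite <- M3, <- M4 in P2.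
  clear M M1 M2 M3 M4.
  set (X0 := phi omega1 (0%R, b) mu 0) in *.
  set (X1 := phi omega1 (0%R, b) mu (1 * RtoC omega1 / 2)) in *.
  set (X2 := phi omega1 (0%R, b) mu (-1 * RtoC omega1 / 2)) in *.
  set (X3 := phi omega1 (0%R, b) mu (Ci * RtoC b / 2)) in *.
  set (X4 := phi omega1 (0%R, b) mu (- Ci * RtoC b / 2)) in *.
  assert (M0' : X0 = RtoC (4 * sin t ^ 2 + 64 * lambda * c - 8 * cos (2 * t))).
  { unfold side_poly in M0. fold c in M0.
    replace (quartic (1 * cos (2 * t)) 0) with 1%R in M0 by (unfold quartic; ring).
    rewrite Cmult_1_l in M0. rewrite M0.
    replace (RtoC (4 * sin t ^ 2) * ((1 * RtoC 0) ^ 4 - RtoC (16 * c) * (1 * RtoC 0) ^ 3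
      + RtoC (4 + 2 * cos (2 * t)) * (1 * RtoC 0) ^ 2 - RtoC (16 * c) * (1 * RtoC 0) + 1))
      with (RtoC (4 * sin t ^ 2)) by ring.
    rewrite <- RtoC_plus. f_equal. ring. }
  fold c in P1, P2. rewrite c2, CS in *. unfold quartic in P1, P2.
  set (y := (c ^ 2)%R) in *. clearbody y X0 X1 X2 X3 X4.
  assert (Q1 : X1 + X2 = RtoC (36 + 12 * (2 * y - 1) + 128 * lambda * c)).
  { replace (1 ^ 4 - 2 * (1 * (2 * y - 1)) * 1 ^ 2 + 1)%R with (4 * (1 - y))%R in P1 by ring.
    assert (N : RtoC (4 * (1 - y)) <> 0) by (intro Q; apply RtoC_inj in Q; lra).
    replace (X1 + X2) with (/ RtoC (4 * (1 - y)) * (RtoC (4 * (1 - y)) * X1 + RtoC (4 * (1 - y)) * X2))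
      by (field; exact N).
    rewrite P1, <- RtoC_inv, <- RtoC_mult by lra. f_equal. field. lra. }
  assert (Q2 : X3 + X4 = RtoC (-28 + 12 * (2 * y - 1) + 128 * lambda * c)).
  { replace (1 ^ 4 - 2 * (-1 * (2 * y - 1)) * 1 ^ 2 + 1)%R with (4 * y)%R in P2 by ring.
    assert (N : RtoC (4 * y) <> 0) by (intro Q; apply RtoC_inj in Q; lra).
    replace (X3 + X4) with (/ RtoC (4 * y) * (RtoC (4 * y) * X3 + RtoC (4 * y) * X4))
      by (field; exact N).
    rewrite P2, <- RtoC_inv, <- RtoC_mult by lra. f_equal. field. lra. }
  replace (2 * X0 + X1 + X2 + X3 + X4) with (2 * X0 + (X1 + X2) + (X3 + X4)) in S by ring.
  rewrite M0', Q1, Q2, <- !RtoC_mult, <- !RtoC_plus in S.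
  apply RtoC_inj in S. lra.
Qed.
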